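(* Let $s\geq 1$ and let $n,k$ be positive integers with $k\leq n$. Let $X_1,\dots,X_n,Y$ be Banach spaces over $\mathbb{K}$ such that $X_j$ has finite cotype $s_j\geq 2$ for $j=1,\dots,k$, and suppose that $$\frac{1}{s}\leq \frac{1}{s_1}+\cdots+\frac{1}{s_k}.$$ Let $(q,\theta)\in[1,\infty]\times(0,1)$, and let $p_1,\dots,p_k$ satisfy, for each $j=1,\dots,k$, $$1\leq p_j\leq 2 \text{ (when } s_j=2\text{)},\qquad 1\leq p_j<s_j^{\ast}\text{ (when } s_j>2\text{)}.$$ Let $0<p<\infty$ be such that $\frac1p\leq \frac{1}{p_1}+\cdots+\frac1{p_k}+\frac{n-k}{q}$, and define $r$ and $r_1,\dots,r_k$ by $$\frac{1}{r}=\frac{1-\theta}{s}+\frac{\theta}{p},\qquad \frac{1}{r_j}=\frac{1-\theta}{1}+\frac{\theta}{p_j}\quad (j=1,\dots,k).$$ Then $$\Pi^{n}_{p;p_1,\dots,p_k,q,\dots,q}(X_1,\dots,X_n;Y)\subseteq \Pi^{n}_{r;r_1,\dots,r_k,q,\dots,q}(X_1,\dots,X_n;Y),$$ where in both classes $q$ is repeated $n-k$ times.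
   Context: All Banach spaces are over $\mathbb{K}=\mathbb{R}$ or $\mathbb{C}$. $\mathcal{L}(X_1,\dots,X_n;Y)$ denotes the space of continuous $n$-linear operators from $X_1\times\cdots\times X_n$ to $Y$. For $1\leq s<\infty$, $s^{\ast}$ is the conjugate exponent of $s$ ($1/s+1/s^{\ast}=1$). The convention $a/\infty=0$ for $a>0$ is used. For $1\leq q<\infty$, $\ell_q^w(X)$ is the set of sequences $(x_j)_{j=1}^\infty\subset X$ with $\sup_{\varphi\in B_{X^*}}\sum_j|\varphi(x_j)|^q<\infty$; $\ell_\infty^w(X)=\ell_\infty(X)$ is the space of bounded sequences in $X$. $\ell_p(Y)$ is the space of sequences $(y_j)$ in $Y$ with $\sum_j\|y_j\|^p<\infty$. For exponents $p,q_1,\dots,q_n$ with $\frac1p\leq\frac1{q_1}+\cdots+\frac1{q_n}$, an operator $T\in\mathcal{L}(X_1,\dots,X_n;Y)$ is absolutely $(p;q_1,\dots,q_n)$-summing if $(T(x_j^{(1)},\dots,x_j^{(n)}))_{j=1}^\infty\in\ell_p(Y)$ whenever $(x_j^{(k)})_{j=1}^\infty\in\ell_{q_k}^w(X_k)$ for $k=1,\dots,n$. The class of all such $T$ is denoted $\Pi^n_{p;q_1,\dots,q_n}(X_1,\dots,X_n;Y)$. *)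

(* Defs.v *)
From HB Require Import structures.
From mathcomp Require Export all_boot all_order all_algebra.
From mathcomp Require Export all_classical all_reals all_analysis.
From mathcomp Require Import complex.
Export numFieldNormedType.Exports.

Set Implicit Arguments.
Unset Strict Implicit.
Unset Printing Implicit Defensive.

Import Order.TTheory GRing.Theory Num.Theory.

Local Open Scope classical_set_scope.
Local Open Scope ring_scope.

Variant scalar_kind := RealScalars | ComplexScalars.

Definition scalar (R : realType) (K : scalar_kind) : numFieldType :=
  match K with
  | RealScalars => R
  | ComplexScalars => R[i]
  end.

Definition real_part (R : realType) (K : scalar_kind) : scalar R K -> R :=
  match K with
  | RealScalars => id
  | ComplexScalars => @complex.Re R
  end.

(* The norm of a normed module over K takes its values in K itself (in R[i] when
   K is complex); [rnorm] reads this nonnegative real scalar as an element of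
   R. *)
Definition rnorm (R : realType) (K : scalar_kind)
    (X : normedModType (scalar R K)) (x : X) : R :=
  real_part `|x|.

Definition dual_ball (R : realType) (K : scalar_kind)
    (X : normedModType (scalar R K)) : set {linear X -> (scalar R K)^o} :=
  [set phi | continuous phi /\ forall x : X, rnorm x <= 1 -> rnorm (phi x) <= 1].

Definition ell (R : realType) (K : scalar_kind) (p : R)
    (Y : normedModType (scalar R K)) : set (nat -> Y) :=
  [set y | (\sum_(0 <= j <oo) (rnorm (y j) `^ p)%:E < +oo)%E].

Arguments dual_ball {R K} X.

(* The index -oo is never used. *)
Definition weak_ell (R : realType) (K : scalar_kind) (q : \bar R)
    (X : normedModType (scalar R K)) : set (nat -> X) :=
  match q with
  | q%:E => [set x | (ereal_sup
      [set (\sum_(0 <= j <oo) (rnorm (phi (x j)) `^ q)%:E)%E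
         | phi in dual_ball X] < +oo)%E]
  | +oo%E => [set x | exists M : R, forall j, rnorm (x j) <= M]
  | -oo%E => set0
  end.

Definition multilinear (F : numFieldType) (n : nat) (X : 'I_n -> normedModType F)
    (Y : normedModType F) (T : (forall i, X i) -> Y) : Prop :=
  forall (x : forall i, X i) (i : 'I_n), linear (fun u : X i => T (dfwith x i u)).

(* L(X_1, ..., X_n; Y), the domain carrying the product topology. *)
Definition cont_multilinear (F : numFieldType) (n : nat)
    (X : 'I_n -> normedModType F) (Y : normedModType F) :
    set ((forall i, X i) -> Y) :=
  [set T | multilinear T /\ continuous (T : prod_topology X -> Y)].

(* The class is only defined for exponents such that
   1/p <= 1/q_1 + ... + 1/q_n; it is empty for all other exponents. *)
Definition summing (R : realType) (K : scalar_kind) (n : nat) (p : R)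
    (q : 'I_n -> \bar R) (X : 'I_n -> normedModType (scalar R K))
    (Y : normedModType (scalar R K)) : set ((forall i, X i) -> Y) :=
  [set T | [/\ ((p^-1)%:E <= \sum_(i < n) (q i)^-1)%E,
    cont_multilinear T &
    forall x : forall i, nat -> X i,
      (forall i, weak_ell (q i) (x i)) ->
      ell p (fun j => T (fun i => x i j))]].

Arguments summing {R K n} p q X Y.

(* The quadratic mean of the norm of \sum_j eps_j x_j over independent uniform
   signs eps_j, i.e. the L^2 norm of t |-> \sum_j r_j(t) x_j on [0, 1] for the
   Rademacher functions r_j. *)
Definition rademacher_mean (R : realType) (K : scalar_kind)
    (X : normedModType (scalar R K)) (m : nat) (x : 'I_m -> X) : R :=
  Num.sqrt ((2 ^+ m)^-1 *
    \sum_(eps : {ffun 'I_m -> bool}) rnorm (\sum_(j < m) (-1) ^+ eps j *: x j) ^+ 2).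

Definition has_cotype (R : realType) (K : scalar_kind) (s : R)
    (X : normedModType (scalar R K)) : Prop :=
  exists C : R, forall (m : nat) (x : 'I_m -> X),
    (\sum_(j < m) rnorm (x j) `^ s) `^ s^-1 <= C * rademacher_mean x.

(* (a_1, ..., a_k, q, ..., q), of length n. *)
Definition exponents (R : realType) (n k : nat) (a : 'I_k -> R) (q : \bar R) :
    'I_n -> \bar R :=
  fun i => if insub (val i) is Some j then (a j)%:E else q.

(* Main.v *)
From HB Require Import structures.
Require Import Defs.
From mathcomp Require Import complex ring lra.
Set Implicit Arguments.
Unset Strict Implicit.
Unset Printing Implicit Defensive.
Import Order.TTheory GRing.Theory Num.Theory.
Local Open Scope classical_set_scope.
Local Open Scope ring_scope.

(** The inclusion is an interpolation statement, but it needs no interpolation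
functor: every weakly summable sequence in one of the first k coordinates can be
rescaled, entry by entry, into two endpoint sequences.

Let x be weakly r_j-summable in X_j, where 1/r_j = (1-theta) + theta/p_j.
[weights_interpolation] provides positive scalars w0(m), w1(m) such that
w0(m)^(1-theta) w1(m)^theta = 1, the sequence w0 x is absolutely s_j-summable, and
w1 x is weakly p_j-summable.  Multilinearity then gives, for T in the smaller
class,
  ||T(x_m)|| = ||T((w0 x)_m)||^(1-theta) ||T((w1 x)_m)||^theta.
The first factor is in l_s, because T is bounded, the remaining coordinates are
bounded, and 1/s <= sum 1/s_j ([ell_cont_multilinear]).  The second one is in l_p,
because T is summing.  Hence the product is in l_r ([powR_interpolate_le]).

For p_j = 1 the weights are 1 and cotype alone suffices ([ell_of_weak_ell1]).  For
p_j > 1, write p and s for p_j and s_j, let rho be the conjugate exponent of r_j, so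
that rho = p'/theta for the conjugate p' of p, and look for weights w0 = F and
w1 = F^(-(1-theta)/theta) with sum F^rho <= 1.  This is a Maurey-Pisier
factorization of the operator a |-> sum_j a_j x_j on l_rho, which is obtained as
follows.

Cotype s, Khinchin's inequality and the theorem of Hahn and Banach give
  sum_i ||sum_j f_ij x_j||^s <= B
for all finite families f whose square function (sum_i |f_ij|^2)^(1/2) has l_rho
norm at most 1 ([rademacher_mean_comb], [cotype_sum_le]).  Take a family that nearly
attains the supremum of the left side and let F be its square function.  Adding one
more vector a to the family and rescaling can hardly increase the left side, and so
  ||sum_j a_j x_j||^s <= eps + B sum_j ((F_j^2 + a_j^2)^(rho/2) - F_j^rho)
([extremal_family]).  Compactness of a product of intervals removes eps and the
restriction to finitely many j ([limit_weights]).  For a = hF with |h| <= 1 the right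
side is at most a multiple of sum_j F_j^rho |h_j|^2 ([exists_weights]).

Thus every functional of norm one on X_j, read as a density g with respect to the
weights d = F^rho, satisfies (sum d g h)^s <= M sum d h^2 for 0 <= h <= 1.  For s = 2
this bounds the second moment of g ([dominated_moment2]); for s > 2 it says that g is
in weak L_(s'), which controls the moments of every order p < s'
([dominated_moment]).  The p-th moment of g is the weak p-sum of w1 x.

This explains the hypotheses p_j <= 2 for s_j = 2 and p_j < s_j' otherwise. *)

(** * Real scalars inside the scalar field *)

Section Scalars.
Variables (R : realType) (K : scalar_kind).
Notation F := (scalar R K).

(** The embedding of the reals into the scalar field; real coefficients suffice for
the whole factorization argument, over both fields. *)
Definition emb : R -> F :=
  match K return R -> scalar R K with
  | RealScalars => id
  | ComplexScalars => fun a => (a%:C)%C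
  end.

Lemma emb0 : emb 0 = 0. Proof. by rewrite /emb; case: (K). Qed.
Lemma emb1 : emb 1 = 1. Proof. by rewrite /emb; case: (K). Qed.
Lemma embD a b : emb (a + b) = emb a + emb b.
Proof. by rewrite /emb; case: (K) => //; exact: (rmorphD (real_complex R)). Qed.
Lemma embN a : emb (- a) = - emb a.
Proof. by rewrite /emb; case: (K) => //; exact: (rmorphN (real_complex R)). Qed.
Lemma embM a b : emb (a * b) = emb a * emb b.
Proof. by rewrite /emb; case: (K) => //; exact: (rmorphM (real_complex R)). Qed.
Lemma emb_sign (b : bool) : emb ((-1) ^+ b) = (-1) ^+ b.
Proof. by case: b; rewrite ?expr0 ?expr1 ?embN emb1. Qed.
Lemma ler_emb a b : (emb a <= emb b) = (a <= b).
Proof. by rewrite /emb; case: (K) => //; exact: lecR. Qed.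
Lemma ltr_emb a b : (emb a < emb b) = (a < b).
Proof. by rewrite /emb; case: (K) => //; exact: ltcR. Qed.
Lemma norm_emb a : `|emb a| = emb `|a|.
Proof.
rewrite /emb; case: (K) => //; rewrite normc_def /= expr0n /= addr0.
by rewrite sqrtr_sqr.
Qed.

Lemma real_partK a : real_part (emb a) = a.
Proof. by rewrite /emb /real_part; case: (K). Qed.
Lemma real_partD (a b : F) : real_part (a + b) = real_part a + real_part b.
Proof. by move: a b; rewrite /real_part; case: (K) => // -[? ?] [? ?]. Qed.
Lemma real_part_emb a (z : F) : real_part (emb a * z) = a * real_part z.
Proof.
move: z; rewrite /emb /real_part; case: (K) => // -[z1 z2] /=.
by rewrite mul0r subr0.
Qed.

Lemma emb_real_part (z : F) : 0 <= z -> emb (real_part z) = z.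
Proof.
move: z; rewrite /emb /real_part; case: (K) => // z z0 /=.
by apply: RRe_real; apply: ger0_real.
Qed.

Section Norm.
Variable X : normedModType F.
Implicit Types x y : X.

Lemma norm_rnorm x : `|x| = emb (rnorm x).
Proof. by rewrite /rnorm emb_real_part. Qed.
Lemma rnorm_ge0 x : 0 <= rnorm x.
Proof. by rewrite -ler_emb -norm_rnorm emb0. Qed.
Lemma rnormD x y : rnorm (x + y) <= rnorm x + rnorm y.
Proof. by rewrite -ler_emb embD -!norm_rnorm ler_normD. Qed.
Lemma emb_inj : injective emb.
Proof. by move=> a b ab; rewrite -(real_partK a) ab real_partK. Qed.
Lemma rnorm0 : rnorm (0 : X) = 0.
Proof. by apply: emb_inj; rewrite -norm_rnorm normr0 emb0. Qed.
Lemma rnorm0_eq0 x : rnorm x = 0 -> x = 0.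
Proof. by move=> x0; apply/eqP; rewrite -normr_eq0 norm_rnorm x0 emb0. Qed.
Lemma rnorm_sum (I : Type) (r : seq I) (P : pred I) (f : I -> X) :
  rnorm (\sum_(i <- r | P i) f i) <= \sum_(i <- r | P i) rnorm (f i).
Proof.
elim/big_ind2: _ => [|x1 x2 y1 y2 h1 h2|//]; first by rewrite rnorm0.
by rewrite (le_trans (rnormD _ _)) // lerD.
Qed.
Lemma rnormN x : rnorm (- x) = rnorm x.
Proof. by rewrite /rnorm normrN. Qed.
End Norm.

Lemma rnormZ (X : normedModType F) (c : F) (x : X) :
  rnorm (c *: x) = rnorm (c : F^o) * rnorm x.
Proof. by apply: emb_inj; rewrite embM -!norm_rnorm normrZ. Qed.
Lemma rnorm_emb (X : normedModType F) a (x : X) :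
  rnorm (emb a *: x) = `|a| * rnorm x.
Proof. by rewrite rnormZ /rnorm [`|_ : F^o|]norm_emb real_partK. Qed.

Lemma rnorm_scalar_complex (z : R[i]) :
  rnorm (z : (scalar R ComplexScalars)^o) =
  Num.sqrt (complex.Re z ^+ 2 + complex.Im z ^+ 2).
Proof. exact: (congr1 (@complex.Re R) (@normc_def R z)). Qed.

Lemma real_part_le_rnorm K' (z : scalar R K') :
  `|real_part z| <= rnorm (z : (scalar R K')^o).
Proof.
case: K' z => [z|[a b]]; first by [].
by rewrite rnorm_scalar_complex -(sqrtr_sqr a) ler_wsqrtr // lerDl sqr_ge0.
Qed.

(** A scalar is controlled by two real parts, which reduces complex functionals to
real ones; k is 'i over the complex numbers, and any k of modulus at most one
works over the reals. *)
Lemma exists_imag_unit K' : exists2 k : scalar R K', rnorm (k : (scalar R K')^o) <= 1 &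
  forall z : scalar R K',
  rnorm (z : (scalar R K')^o) <= `|real_part z| + `|real_part (k * z)|.
Proof.
case: K'.
  exists 1 => [|z]; rewrite /rnorm /= ?normr1 //.
  by rewrite mul1r lerDl.
exists ('i%C : R[i]) => [|z]; rewrite rnorm_scalar_complex.
  by rewrite /= expr0n expr1n add0r sqrtr1.
case: z => a b /=; rewrite mul0r mul1r sub0r normrN -[leRHS]ger0_norm ?addr_ge0 // -sqrtr_sqr.
rewrite ler_wsqrtr // sqrrD !real_normK ?num_real //.
by have := mulr_ge0 (normr_ge0 a) (normr_ge0 b); lra.
Qed.

End Scalars.

(** * Norming functionals *)

Section HahnBanach.
Variables (R : realType) (K : scalar_kind) (X : normedModType (scalar R K)).
Implicit Types (x y : X) (q : X -> R) (t : R).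
Notation "t *% x" := (emb K t *: x) (at level 40).

Definition sublinear q :=
  (forall x y, q (x + y) <= q x + q y) /\
  (forall t x, 0 <= t -> q (t *% x) <= t * q x).

Lemma rscaleA t u x : t *% (u *% x) = (t * u) *% x.
Proof. by rewrite scalerA embM. Qed.
Lemma rscale1 x : 1 *% x = x.
Proof. by rewrite emb1 scale1r. Qed.
Lemma rscale0 x : 0 *% x = 0.
Proof. by rewrite emb0 scale0r. Qed.
Lemma rscaleD t u x : (t + u) *% x = t *% x + u *% x.
Proof. by rewrite embD scalerDl. Qed.

Lemma sublinear0 q : sublinear q -> q 0 = 0.
Proof.
move=> [qD qZ]; have := qD 0 0; have := qZ 0 0 (lexx 0).
by rewrite rscale0 mul0r addr0; lra.
Qed.

Lemma sublinearZ q t x : sublinear q -> 0 <= t -> q (t *% x) = t * q x.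
Proof.
move=> sq t0; have [qD qZ] := sq.
have [->|tN0] := eqVneq t 0; first by rewrite rscale0 mul0r sublinear0.
have tp : 0 < t by rewrite lt0r tN0.
apply/eqP; rewrite eq_le qZ //= -ler_pdivlMl //.
have := qZ t^-1 (t *% x); rewrite invr_ge0 rscaleA mulVf // rscale1.
exact.
Qed.

Lemma sublinearN q x : sublinear q -> - q (- x) <= q x.
Proof.
by move=> sq; have := sq.1 x (- x); rewrite subrr sublinear0 //; lra.
Qed.

(** The infimum over t >= 0 of q (x + t y) - t q y is again sublinear, since it is
bounded below by - q (- x).  The lowering serves twice: to fix the value of a
functional at a given vector, and to show that a minimal sublinear functional is
additive. *)
Lemma sublinear_lower q y : sublinear q ->
  exists q', [/\ sublinear q', forall x, q' x <= q x & q' (- y) <= - q y].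
Proof.
move=> sq; have [qD qZ] := sq.
pose E x := [set q (x + t *% y) - t * q y | t in [set t | 0 <= t]].
have Elb x : lbound (E x) (- q (- x)).
  move=> _ [t /= t0 <-]; rewrite -(sublinearZ y sq t0).
  have := qD (x + t *% y) (- x); rewrite addrAC subrr add0r; lra.
have hE x : has_lbound (E x) by exists (- q (- x)).
have E0 x : E x !=set0 by exists (q (x + 0 *% y) - 0 * q y); exists 0 => /=.
have le_q' x t : 0 <= t -> inf (E x) <= q (x + t *% y) - t * q y.
  by move=> t0; apply: ge_inf => //; exists t.
exists (fun x => inf (E x)); split; last 2 first.
- by move=> x; have := le_q' x 0 (lexx 0); rewrite rscale0 mul0r addr0 subr0.
- have := le_q' (- y) 1 ler01.
  by rewrite rscale1 addNr sublinear0 // mul1r sub0r.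
split=> [x1 x2|t x t0].
  rewrite /= -lerBlDr; apply: lb_le_inf => // _ [t1 /= t10 <-].
  rewrite lerBlDl -lerBlDr; apply: lb_le_inf => // _ [t2 /= t20 <-].
  rewrite lerBlDr; apply: (le_trans (le_q' _ (t1 + t2) (addr_ge0 t10 t20))).
  have := qD (x1 + t1 *% y) (x2 + t2 *% y).
  rewrite addrACA -rscaleD mulrDl; lra.
have [->|tN0] := eqVneq t 0.
  have := le_q' (0 *% x) 0 (lexx 0).
  by rewrite !rscale0 !mul0r addr0 subr0 sublinear0.
have tp : 0 < t by rewrite lt0r tN0.
rewrite -ler_pdivrMl //; apply: lb_le_inf => // _ [u /= u0 <-].
rewrite ler_pdivrMl //; apply: (le_trans (le_q' _ (t * u) (mulr_ge0 t0 u0))).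
by rewrite -rscaleA -scalerDr sublinearZ // mulrBr mulrA.
Qed.

(** Zorn's lemma applies because the pointwise infimum of a chain of sublinear
functionals below p is sublinear, - p (- x) being a common lower bound. *)
Lemma exists_min_sublinear p : sublinear p -> exists f, [/\ sublinear f,
  forall x, f x <= p x &
  forall q, sublinear q -> (forall x, q x <= f x) -> forall x, f x <= q x].
Proof.
move=> sp; pose T := {q : X -> R | sublinear q /\ forall x, q x <= p x}.
have aP (a : T) : sublinear (sval a) /\ forall x, sval a x <= p x by exact: (svalP a).
pose t0 : T := exist _ p (conj sp (fun x => lexx (p x))).
pose le (a b : T) := `[< forall x, sval b x <= sval a x >].
have [|||[f [sf fp]] fmin] := @ZL_preorder T t0 le.
- by move=> a; apply/asboolP.
- move=> b a c /asboolP ba /asboolP ac; apply/asboolP => x.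
  exact: le_trans (ac x) (ba x).
- move=> A Atot.
  have [[a0 Aa0]|noA] := pselect (exists a, A a); last first.
    by exists t0 => s As; exfalso; apply: noA; exists s.
  pose E x := [set sval a x | a in A].
  have hE x : has_lbound (E x).
    exists (- p (- x)) => _ [[a [sa ap]] Aa <-] /=.
    by apply: le_trans (sublinearN x sa); rewrite lerN2.
  have E0 x : E x !=set0 by exists (sval a0 x); exists a0.
  have leE x a : A a -> inf (E x) <= sval a x.
    by move=> Aa; apply: ge_inf => //; exists a.
  have sE : sublinear (fun x => inf (E x)).
    split=> [x y|t x tge0].
      rewrite /= -lerBlDr; apply: lb_le_inf => // _ [a1 Aa1 <-].
      rewrite lerBlDl -lerBlDr; apply: lb_le_inf => // _ [a2 Aa2 <-].
      rewrite lerBlDr.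
      have sub (a : T) : sval a (x + y) <= sval a x + sval a y.
        by case: (aP a) => -[+ _] _; exact.
      case: (Atot _ _ Aa1 Aa2) => /asboolP h.
        apply: (le_trans (leE _ _ Aa2)); apply: (le_trans (sub a2)).
        by rewrite addrC lerD2l.
      apply: (le_trans (leE _ _ Aa1)); apply: (le_trans (sub a1)).
      by rewrite addrC lerD2r.
    have [->|tN0] := eqVneq t 0.
      rewrite rscale0 mul0r; apply: (le_trans (leE _ _ Aa0)).
      by case: (aP a0) => /sublinear0 -> _.
    have tp : 0 < t by rewrite lt0r tN0.
    rewrite -ler_pdivrMl //; apply: lb_le_inf => // _ [a Aa <-].
    rewrite ler_pdivrMl //; apply: (le_trans (leE _ _ Aa)).
    by case: (aP a) => -[_ +] _; exact.
  have Ep x : inf (E x) <= p x.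
    by apply: le_trans (leE _ _ Aa0) _; case: (aP a0).
  exists (exist _ (fun x => inf (E x)) (conj sE Ep)) => s As; apply/asboolP => x /=.
  exact: leE.
exists f; split=> // q sq qf.
have qp x : q x <= p x by exact: le_trans (qf x) (fp x).
have := fmin (exist _ q (conj sq qp)).
by move=> /(_ (introT (asboolP _) qf)) /asboolP.
Qed.

(** Lower p in the direction v and take a minimal sublinear functional f below the
result.  Lowering f in any direction cannot change it, which forces additivity,
and the first lowering forces f v = p v. *)
Lemma real_hahn_banach p v : sublinear p -> exists f : X -> R,
  [/\ forall x y, f (x + y) = f x + f y,
      forall t x, f (t *% x) = t * f x,
      forall x, f x <= p x & f v = p v].
Proof.
move=> sp; have [p0 [sp0 p0p p0v]] := sublinear_lower v sp.
have [f [sf fp0 fmin]] := exists_min_sublinear sp0.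
have [fsub _] := sf.
have fD x y : f (x + y) = f x + f y.
  apply/eqP; rewrite eq_le fsub /=.
  have [q [sq qf qy]] := sublinear_lower y sf.
  have := fmin q sq qf (x) => h1.
  have := fmin q sq qf (x + y) => h2.
  have := sq.1 (x + y) (- y); rewrite addrK => h3.
  have := qf (x + y); lra.
have fN x : f (- x) = - f x.
  by have := fD x (- x); rewrite subrr sublinear0 //; lra.
exists f; split=> //.
- move=> t x; have [t0|t0] := leP 0 t; first exact: sublinearZ.
  have := sublinearZ x sf (_ : 0 <= - t).
  by rewrite embN scaleNr fN oppr_ge0 ltW // => /(_ isT); lra.
- by move=> x; exact: le_trans (fp0 x) (p0p x).
- apply/eqP; rewrite eq_le (le_trans (fp0 v)) //=.
  by have := fp0 (- v); rewrite fN; lra.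
Qed.

Lemma sublinear_rnorm : sublinear (@rnorm R K X).
Proof.
by split=> [x y|t x t0]; [exact: rnormD | rewrite rnorm_emb ger0_norm].
Qed.

End HahnBanach.

Lemma bounded_dual_ball (R : realType) (K : scalar_kind)
    (X : normedModType (scalar R K)) (phi : {linear X -> (scalar R K)^o}) :
  (forall x, rnorm (phi x) <= rnorm x) -> dual_ball X phi.
Proof.
move=> le_phi; split; last by move=> x; exact: le_trans (le_phi x).
apply/linear_bounded_continuous/bounded_funP => r; exists r => x.
by apply: le_trans; rewrite !norm_rnorm ler_emb.
Qed.

Lemma dual_ball_le (R : realType) (K : scalar_kind)
    (X : normedModType (scalar R K)) (phi : {linear X -> (scalar R K)^o}) x :
  dual_ball X phi -> rnorm (phi x) <= rnorm x.
Proof.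
move=> [_ h]; have [x0|xN0] := eqVneq (rnorm x) 0.
  by rewrite (rnorm0_eq0 x0) linear0 !rnorm0.
have xp : 0 < rnorm x by rewrite lt0r xN0 rnorm_ge0.
have := h (emb K (rnorm x)^-1 *: x).
rewrite linearZ /= !rnorm_emb ger0_norm ?invr_ge0 ?rnorm_ge0 // mulVf // lexx.
by move=> /(_ isT); rewrite ler_pdivrMl // mulr1.
Qed.

(** Over the complex numbers the real functional f extends to f x - i f (i x), whose
modulus is bounded by testing f on the product of x with the conjugate of the
value at x. *)
Lemma norming_functional (R : realType) (K : scalar_kind)
    (X : normedModType (scalar R K)) (v : X) :
  exists2 phi : {linear X -> (scalar R K)^o}, dual_ball X phi &
    real_part (phi v) = rnorm v.
Proof.
have [f [fD fZ fle fv]] := real_hahn_banach v (@sublinear_rnorm R K X).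
have fN x : f (- x) = - f x.
  by have := fZ (-1) x; rewrite embN emb1 !mulN1r scaleN1r.
case: K X v f fD fZ fle fv fN => X v f fD fZ fle fv fN.
  have flin : linear (f : X -> (scalar R RealScalars)^o).
    by move=> a x y; rewrite fD fZ.
  pose L : {linear X -> (scalar R RealScalars)^o} :=
    HB.pack (f : X -> (scalar R RealScalars)^o) (GRing.isLinear.Build _ _ _ _ _ flin).
  exists L => //; apply: bounded_dual_ball => x.
  by rewrite [leLHS](_ : _ = `|f x|) // ler_norml fle lerNl -fN -(rnormN x) fle.
pose g (x : X) : (scalar R ComplexScalars)^o :=
  ((f x) -i* (f (('i%C : scalar R ComplexScalars) *: x)))%C.
have glin : linear g.
  move=> [a1 a2] x y.
  have E (z : X) : ((a1 +i* a2)%C : scalar R ComplexScalars) *: z =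
      emb ComplexScalars a1 *: z +
      emb ComplexScalars a2 *: (('i%C : scalar R ComplexScalars) *: z).
    rewrite scalerA -scalerDl; congr (_ *: _).
    by apply/eqP; rewrite eq_complex /= !(mul0r, mulr0, mulr1, addr0, add0r, subr0) !eqxx.
  have ii (z : X) : ('i%C : scalar R ComplexScalars) *:
      (('i%C : scalar R ComplexScalars) *: z) = - z.
    rewrite scalerA -scaleN1r; congr (_ *: _).
    by apply/eqP; rewrite eq_complex /= !(mul0r, mulr0, mulr1, addr0, add0r, sub0r, oppr0) !eqxx.
  apply/eqP; rewrite eq_complex /= scalerDr [in X in _ && X]E !E scalerDr.
  rewrite !fD !(scalerA ('i%C : scalar R ComplexScalars))
    ![('i%C : scalar R ComplexScalars) * emb _ _]mulrC -!scalerA !ii !fZ fN.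
  by apply/andP; split; apply/eqP; ring.
pose L : {linear X -> (scalar R ComplexScalars)^o} :=
  HB.pack g (GRing.isLinear.Build _ _ _ _ _ glin).
exists L => //; apply: bounded_dual_ball => x.
have [->|z0] := eqVneq (rnorm (L x)) 0; first exact: rnorm_ge0.
have zp : 0 < rnorm (L x) by rewrite lt0r z0 rnorm_ge0.
rewrite -(ler_pM2l zp).
pose c : scalar R ComplexScalars := conjc (L x).
have -> : rnorm (L x) * rnorm (L x) = f (c *: x).
  rewrite rnorm_scalar_complex -expr2 sqr_sqrtr ?addr_ge0 ?sqr_ge0 //.
  transitivity (complex.Re (L (c *: x))) => //.
  by rewrite linearZ /= -!expr2 mulNr opprK -expr2.
apply: (le_trans (fle _)); rewrite rnormZ ler_wpM2r ?rnorm_ge0 //.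
by rewrite !rnorm_scalar_complex /= sqrrN.
Qed.

(** * Khinchin's inequality *)

Section Khinchin.
Variable R : realType.
Implicit Types (b x rho : R).

Lemma cosh_le_expR_sqr b : (expR b + expR (- b)) / 2 <= expR (2 * b ^+ 2).
Proof.
wlog b0 : b / 0 <= b => [h|].
  have [/h//|/ltW] := leP 0 b; rewrite -oppr_ge0 => /h.
  by rewrite opprK sqrrN addrC.
have [b2|b2] := leP b (1 / 2); last first.
  have h1 : expR b <= expR (2 * b ^+ 2) by rewrite ler_expR; nra.
  have h2 : expR (- b) <= expR b by rewrite ler_expR; lra.
  lra.
(* For 0 <= b <= 1/2, exp b <= 1/(1-b) and exp(-b) <= 1/(1+b), and the mean of
   these bounds is 1/(1-b^2) <= 1+2b^2. *)
have inv_le (c : R) : c < 1 -> expR c <= (1 - c)^-1.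
  move=> c1; rewrite -[expR c]invrK lef_pV2 ?posrE ?subr_gt0 ?invr_gt0 ?expR_gt0 //.
  by rewrite -expRN; exact: expR_ge1Dx.
have h1 := inv_le b ltac:(lra); have h2 := inv_le (- b) ltac:(lra).
apply: le_trans (expR_ge1Dx _).
have : (1 - b)^-1 + (1 - - b)^-1 <= 2 * (1 + 2 * b ^+ 2); last by lra.
have -> : (1 - b)^-1 + (1 - - b)^-1 = 2 / (1 - b ^+ 2).
  by field; apply/and3P; split; rewrite gt_eqF //; nra.
have u0 : 0 <= b ^+ 2 by rewrite sqr_ge0.
have u1 : b ^+ 2 <= 1 / 4 by nra.
by rewrite ler_pdivrMr; nra.
Qed.

Lemma rademacher_exp_moment n (b : 'I_n -> R) :
  \sum_(eps : {ffun 'I_n -> bool}) expR (\sum_(i < n) (-1) ^+ eps i * b i) <=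
  2 ^+ n * expR (2 * \sum_(i < n) b i ^+ 2).
Proof.
under eq_bigr do rewrite expR_sum.
rewrite -(bigA_distr_bigA (fun i (e : bool) => expR ((-1) ^+ e * b i))) /=.
have -> : (2 : R) ^+ n = \prod_(i < n) 2 by rewrite prodr_const card_ord.
rewrite mulr_sumr expR_sum -big_split /=.
apply: ler_prod => i _; rewrite sumr_ge0 => [|e _]; last exact: expR_ge0.
rewrite big_bool /= expr0 expr1 mulN1r mul1r.
by have := cosh_le_expR_sqr (b i); lra.
Qed.

Lemma powR_le_expR rho : 0 <= rho ->
  exists2 c : R, 0 < c & forall x, `|x| `^ rho <= c * (expR x + expR (- x)).
Proof.
move=> rho0; pose N := (Num.truncn rho).+1.
have rhoN : rho <= N%:R by apply/ltW/truncnS_gt.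
have f0 : 0 < (N`!%:R : R) by rewrite ltr0n fact_gt0.
have f1 : 1 <= (N`!%:R : R) by rewrite ler1n fact_gt0.
exists N`!%:R => // x.
have le_abs : expR `|x| <= expR x + expR (- x).
  have [_|_] := ger0P x; have := expR_ge0 x; have := expR_ge0 (- x); lra.
apply: (@le_trans _ _ (N`!%:R * expR `|x|)); last by rewrite ler_pM2l.
apply: (@le_trans _ _ (N`!%:R * (1 + `|x| ^+ N / N`!%:R))); last first.
  by rewrite ler_pM2l // expR_ge1Dxn.
rewrite mulrDr mulr1 mulrCA divff ?mulr1 ?gt_eqF //.
have [x1|x1] := leP `|x| 1.
  have : `|x| `^ rho <= 1 `^ rho by rewrite ge0_ler_powR ?nnegrE.
  by rewrite powR1; have := exprn_ge0 N (normr_ge0 x); lra.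
have : `|x| `^ rho <= `|x| `^ N%:R by rewrite ler_powR // ltW.
by rewrite powR_mulrn //; lra.
Qed.

(** By homogeneity one may assume that the squares of the b_i sum to one; then all
exponential moments of the random sum are bounded, and they dominate its moments
of every order. *)
Lemma khinchin rho : 0 < rho -> exists2 c : R, 0 < c &
  forall n (b : 'I_n -> R),
  (2 ^+ n)^-1 * \sum_(eps : {ffun 'I_n -> bool})
     `|\sum_(i < n) (-1) ^+ eps i * b i| `^ rho
  <= c * (\sum_(i < n) b i ^+ 2) `^ (rho / 2).
Proof.
move=> rho0; have [c c0 hc] := powR_le_expR (ltW rho0).
exists (c * (2 * expR 2)); first by rewrite !mulr_gt0 // expR_gt0.
move=> n b; have two0 : 0 < (2 ^+ n : R) by rewrite exprn_gt0.
rewrite ler_pdivrMl //.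
set S := \sum_(i < n) b i ^+ 2.
have S0 : 0 <= S by apply: sumr_ge0 => i _; rewrite sqr_ge0.
have [Se|SN0] := eqVneq S 0.
  have b0 i : b i = 0.
    move/eqP: Se; rewrite psumr_eq0 => [/allP/(_ i)|j _]; last exact: sqr_ge0.
    by rewrite mem_index_enum sqrf_eq0 => /(_ isT)/eqP.
  rewrite big1 ?mulr_ge0 ?powR_ge0 ?ltW ?expR_gt0 // => eps _.
  rewrite big1 ?normr0 ?powR0 ?gt_eqF // => i _.
  by rewrite b0 mulr0.
have Sp : 0 < S by rewrite lt0r SN0.
pose sg := Num.sqrt S; have sg0 : 0 < sg by rewrite sqrtr_gt0.
have sg2 : sg ^+ 2 = S by rewrite sqr_sqrtr.
pose b' i := b i / sg.
have b'S : \sum_(i < n) b' i ^+ 2 = 1.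
  under eq_bigr do rewrite expr_div_n sg2.
  by rewrite -mulr_suml divff.
have sgrho : S `^ (rho / 2) = sg `^ rho.
  by rewrite /sg -powR12_sqrt // -powRrM mulrC.
have E (eps : {ffun 'I_n -> bool}) : `|\sum_(i < n) (-1) ^+ eps i * b i| `^ rho =
    sg `^ rho * `|\sum_(i < n) (-1) ^+ eps i * b' i| `^ rho.
  rewrite -powRM // ?ltW //; congr (_ `^ _).
  rewrite -{1}(gtr0_norm sg0) -normrM mulr_sumr; congr `|_|.
  by apply: eq_bigr => i _; rewrite /b'; field; rewrite gt_eqF.
under eq_bigr do rewrite E.
rewrite -mulr_sumr sgrho mulrCA [leRHS]mulrA [leRHS]mulrC.
rewrite ler_pM2l ?powR_gt0 //.
apply: (@le_trans _ _ (c * (\sum_(eps : {ffun 'I_n -> bool})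
    expR (\sum_(i < n) (-1) ^+ eps i * b' i) +
    \sum_(eps : {ffun 'I_n -> bool})
    expR (\sum_(i < n) (-1) ^+ eps i * - b' i)))).
  rewrite -big_split mulr_sumr; apply: ler_sum => eps _ /=.
  have -> : \sum_(i < n) (-1) ^+ eps i * - b' i =
      - \sum_(i < n) (-1) ^+ eps i * b' i.
    by rewrite -sumrN; apply: eq_bigr => i _; rewrite mulrN.
  exact: hc.
have := rademacher_exp_moment b'; have := rademacher_exp_moment (fun i => - b' i).
under [X in 2 * X]eq_bigr do rewrite sqrrN.
rewrite b'S mulr1 => h1 h2.
rewrite -mulrA ler_pM2l //; lra.
Qed.

End Khinchin.

(** * Extremal families *)

Section Extremal.
Variable R : realType.
Implicit Types (a : nat -> R) (m : nat).

(** Near-extremality of a family f for the sum of the N (f_i)^s leaves no room for a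
further vector a: the enlarged family, divided by (1 + D)^(1/rho), is admissible,
where D is the increase of the constraint, and (1 + D)^(s/rho) <= 1 + D because
s <= rho.  Here G stands for the squared square function. *)
Lemma extremal_family (N : (nat -> R) -> R) (m : nat) (s rho B e : R) :
  0 < s -> s <= rho -> 0 <= B -> 0 < e ->
  (forall a, 0 <= N a) ->
  (forall c a, 0 <= c -> N (fun j => c * a j) = c * N a) ->
  (forall n (f : 'I_n -> nat -> R),
    \sum_(j < m) (\sum_(i < n) f i j ^+ 2) `^ (rho / 2) <= 1 ->
    \sum_(i < n) N (f i) `^ s <= B) ->
  exists G : nat -> R, [/\ forall j, 0 <= G j,
    \sum_(j < m) G j `^ (rho / 2) <= 1 &
    forall a, N a `^ s <=
      e + B * \sum_(j < m) ((G j + a j ^+ 2) `^ (rho / 2) - G j `^ (rho / 2))].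
Proof.
move=> s0 srho B0 e0 N0 NZ NB.
have rho0 : 0 < rho by exact: lt_le_trans srho.
have k0 : 0 < rho / 2 by rewrite divr_gt0.
pose feas n (f : 'I_n -> nat -> R) :=
  \sum_(j < m) (\sum_(i < n) f i j ^+ 2) `^ (rho / 2) <= 1.
pose E := [set v | exists n (f : 'I_n -> nat -> R),
  feas n f /\ v = \sum_(i < n) N (f i) `^ s].
have EB : ubound E B by move=> _ [n [f [hf ->]]]; exact: NB.
have E0 : E !=set0.
  exists (\sum_(i < 0) N ((fun _ _ => 0) i) `^ s), 0%N, (fun _ _ => 0); split=> //.
  rewrite /feas big1 // => j _; rewrite big_ord0 powR0 // gt_eqF //.
have hE : has_sup E by split=> //; exists B.
have [_ [n [f [hf ->]]] hfe] := sup_adherent e0 hE.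
have SB : sup E <= B by exact: ge_sup.
pose G j := \sum_(i < n) f i j ^+ 2; exists G.
have G0 j : 0 <= G j by apply: sumr_ge0 => i _; rewrite sqr_ge0.
split=> // a; set D := \sum_(j < m) _.
have D0 : 0 <= D.
  apply: sumr_ge0 => j _; rewrite subr_ge0 ge0_ler_powR ?nnegrE ?lerDl ?sqr_ge0 //.
    exact: ltW.
  by rewrite addr_ge0 // sqr_ge0.
have D1 : 0 < 1 + D by rewrite ltr_pwDl.
(* The factor that makes the family enlarged by a admissible again. *)
pose c := (1 + D) `^ rho^-1.
have c0 : 0 < c by rewrite powR_gt0.
have crho : c `^ rho = 1 + D by rewrite -powRrM mulVf ?gt_eqF // powRr1 // ltW.
have cs : c `^ s <= 1 + D.
  rewrite -crho ler_powR //.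
  have <- : 1 `^ rho^-1 = 1 :> R by rewrite powR1.
  by rewrite ge0_ler_powR ?nnegrE ?invr_ge0 ?(ltW rho0) ?(ltW D1) // lerDl.
(* Index 0 of the enlarged family carries the new vector a. *)
pose g (i : 'I_n.+1) j := c^-1 * (if unlift ord0 i is Some i' then f i' j else a j).
have gE j : \sum_(i < n.+1) g i j ^+ 2 = (G j + a j ^+ 2) / c ^+ 2.
  rewrite big_ord_recl /g unlift_none.
  under eq_bigr do rewrite liftK exprMn.
  by rewrite -mulr_sumr -/(G j) exprMn exprVn; ring.
have hg : feas n.+1 g.
  have gE' j : (\sum_(i < n.+1) g i j ^+ 2) `^ (rho / 2) =
      (G j + a j ^+ 2) `^ (rho / 2) * (c ^+ 2)^-1 `^ (rho / 2).
    by rewrite gE powRM ?invr_ge0 ?sqr_ge0 // addr_ge0 ?sqr_ge0.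
  rewrite /feas; under eq_bigr do rewrite gE'.
  rewrite -mulr_suml.
  have -> : (c ^+ 2)^-1 `^ (rho / 2) = (1 + D)^-1.
    rewrite -powR_inv1 ?exprn_ge0 ?ltW // -powR_mulrn ?ltW // -powRrM -powRrM.
    have -> : 2%:R * (-1 * (rho / 2)) = - rho by field.
    by rewrite powRN crho.
  rewrite ler_pdivrMr // mul1r.
  have -> : \sum_(j < m) (G j + a j ^+ 2) `^ (rho / 2) =
      \sum_(j < m) G j `^ (rho / 2) + D.
    by rewrite /D -big_split /=; apply: eq_bigr => j _; rewrite addrC subrK.
  by rewrite lerD2r.
have : \sum_(i < n.+1) N (g i) `^ s <= sup E.
  by apply: ub_le_sup; [exists B | exists n.+1, g].
have Ng (i : 'I_n.+1) : N (g i) `^ s =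
    (c `^ s)^-1 * N (fun j => if unlift ord0 i is Some i' then f i' j else a j) `^ s.
  rewrite /g NZ ?invr_ge0 ?(ltW c0) // powRM ?invr_ge0 ?(ltW c0) //; congr (_ * _).
  by rewrite -powR_inv1 ?ltW // -powRrM mulN1r powRN.
under eq_bigr do rewrite Ng.
have cs0 : 0 < c `^ s by rewrite powR_gt0.
rewrite -mulr_sumr ler_pdivrMl // big_ord_recl unlift_none.
under eq_bigr do rewrite liftK.
move=> h; have {}h : N a `^ s + \sum_(i < n) N (f i) `^ s <= c `^ s * sup E := h.
have S0 : 0 <= sup E.
  apply: le_trans (_ : \sum_(i < n) N (f i) `^ s <= _).
    by apply: sumr_ge0 => i _; rewrite powR_ge0.
  by apply: ub_le_sup; [exists B | exists n, f].
have h2 : c `^ s * sup E <= (1 + D) * sup E by rewrite ler_wpM2r.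
have h3 : D * sup E <= B * D by rewrite mulrC ler_wpM2r.
lra.
Qed.

(** The absolute value is there because the power function takes the value 1 at
negative numbers. *)
Lemma continuous_normr_powR (k : R) : 1 <= k ->
  continuous (fun x : R => `|x| `^ k).
Proof.
move=> k1 x; have k0 : 0 < k by exact: lt_le_trans k1.
have nb0 (e : R) : 0 < e -> \forall y \near (0 : R), `|y| <= e.
  by move=> e0; apply: (@cvgr0_norm_le R R^o R (nbhs 0) _ (fun x => x)) => //; exact: cvg_id.
have [->|xN0] := eqVneq x 0.
  rewrite /continuous_at normr0 powR0 ?gt_eqF //.
  apply/cvgrPdist_le => e e0; near=> y.
  rewrite sub0r normrN ger0_norm ?powR_ge0 //.
  have [->|yN0] := eqVneq y 0; first by rewrite normr0 powR0 ?gt_eqF // ltW.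
  have y0 : 0 < `|y| by rewrite normr_gt0.
  apply: (@le_trans _ _ `|y|).
    apply: ge1r_powR => //; rewrite y0 /=.
    by near: y; apply: nb0.
  by near: y; apply: nb0.
have h1 : `|y| @[y --> x] --> `|x| := @norm_continuous R R^o x.
have h2 : ln `|y| @[y --> x] --> ln `|x|.
  by apply: continuous_cvg h1; apply: continuous_ln; rewrite normr_gt0.
have h3 : k * ln `|y| @[y --> x] --> k * ln `|x|.
  by apply: cvgM h2; exact: cvg_cst.
have h4 : expR (k * ln `|y|) @[y --> x] --> expR (k * ln `|x|).
  by apply: continuous_cvg h3; exact: continuous_expR.
rewrite /continuous_at; have -> : `|x| `^ k = expR (k * ln `|x|).
  by rewrite /powR normr_eq0 (negbTE xN0).
apply: cvg_trans h4.
apply: near_eq_cvg; near=> y.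
rewrite /powR normr_eq0 ifF //; apply/negbTE.
by near: y; apply: (@cvgr_neq0 _ _ _ _ _ (fun z : R => z)) xN0; exact: cvg_id.
Unshelve. all: by end_near. Qed.

End Extremal.

Section Limit.
Variable R : realType.
Notation seqs := (prod_topology (fun _ : nat => R)).

Lemma cvg_sum (T I : Type) (F : set_system T) (FF : Filter F) (r : seq I)
    (f : I -> T -> R) (l : I -> R) :
  (forall i, f i x @[x --> F] --> l i) ->
  \sum_(i <- r) f i x @[x --> F] --> \sum_(i <- r) l i.
Proof. by move=> h; apply: cvg_big => [|i _] //; exact: (@add_continuous R^o). Qed.

Lemma cluster_ge (T : topologicalType) (F : set_system T) (FF : ProperFilter F)
    (Phi : T -> R) (c : R) (p : T) :
  continuous Phi -> F [set G | c <= Phi G] -> cluster F p -> c <= Phi p.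
Proof.
move=> Phic Fc pF; rewrite leNgt; apply/negP => lt_c.
have nb : nbhs p [set G | Phi G < c].
  by have := Phic p; move=> /cvgr_lt; exact.
by have [G [/= h1 h2]] := pF _ _ Fc nb; move: (le_lt_trans h1 h2); rewrite ltxx.
Qed.

Lemma continuous_coord (j : nat) : continuous (fun G : seqs => G j).
Proof. exact: (@proj_continuous nat (fun=> R) j). Qed.

Lemma continuous_sum_coords (k : R) (a : nat -> R) (m : nat) : 1 <= k ->
  continuous (fun G : seqs =>
    \sum_(j < m) (`|G j + a j| `^ k - `|G j| `^ k)).
Proof.
move=> k1 G.
apply: (@cvg_sum _ _ (nbhs G) _ (index_enum 'I_m)
  (fun (j : 'I_m) (H : seqs) => `|H j + a j| `^ k - `|H j| `^ k)
  (fun j : 'I_m => `|G j + a j| `^ k - `|G j| `^ k)) => j.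
have pk := continuous_normr_powR k1.
have h0 : H j @[H --> G] --> G j := @continuous_coord j G.
have h1 : H j + a j @[H --> G] --> G j + a j.
  by apply: cvgD h0 _; exact: cvg_cst.
apply: cvgB; [exact: continuous_cvg (pk _) h1 | exact: continuous_cvg (pk _) h0].
Qed.

Lemma continuous_sum_powR (k : R) (m : nat) : 1 <= k ->
  continuous (fun G : seqs => \sum_(j < m) `|G j| `^ k).
Proof.
move=> k1 G.
apply: (@cvg_sum _ _ (nbhs G) _ (index_enum 'I_m)
  (fun (j : 'I_m) (H : seqs) => `|H j| `^ k)
  (fun j : 'I_m => `|G j| `^ k)) => j.
have pk := continuous_normr_powR k1.
have h0 : H j @[H --> G] --> G j := @continuous_coord j G.
exact: continuous_cvg (pk _) h0.
Qed.

(** The near-extremal weights, truncated to the first m coordinates, lie in a product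
of unit intervals, which is compact.  Each inequality in the conclusion involves
finitely many coordinates, so a cluster point inherits it. *)
Lemma limit_weights (N : nat -> (nat -> R) -> R) (k s B : R) :
  1 <= k -> 0 <= B ->
  (forall m m' a, (m <= m')%N -> (forall j, (m <= j)%N -> a j = 0) ->
     N m' a = N m a) ->
  (forall m e, 0 < e -> exists G : nat -> R, [/\ forall j, 0 <= G j,
    \sum_(j < m) G j `^ k <= 1 &
    forall a, N m a `^ s <=
      e + B * \sum_(j < m) ((G j + a j ^+ 2) `^ k - G j `^ k)]) ->
  exists G : nat -> R, [/\ forall j, 0 <= G j,
    forall m, \sum_(j < m) G j `^ k <= 1 &
    forall m a, (forall j, (m <= j)%N -> a j = 0) -> N m a `^ s <=
      B * \sum_(j < m) ((G j + a j ^+ 2) `^ k - G j `^ k)].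
Proof.
move=> k1 B0 NE H; have k0 : 0 < k by exact: lt_le_trans k1.
have e0 m : 0 < (m.+1%:R^-1 : R) by rewrite invr_gt0.
have /choice[G0 hG0] := fun m => H m _ (e0 m).
pose G m : seqs := fun j => if (j < m)%N then G0 m j else 0.
have G_ge0 m j : 0 <= G m j.
  by rewrite /G; case: ifP => // _; case: (hG0 m).
have G_le1 m j : G m j <= 1.
  rewrite /G; case: ifP => // jm; case: (hG0 m) => G00 S1 _.
  rewrite leNgt; apply/negP => gt1.
  have : G0 m j `^ k <= 1.
    apply: le_trans S1; rewrite (bigD1 (Ordinal jm)) //= lerDl.
    by apply: sumr_ge0 => i _; exact: powR_ge0.
  by have := le1r_powR (ltW gt1) k1; lra.
pose A := [set f : seqs | forall i, `[0%R, (1 : R)]%classic (f i)].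
have cA : compact A.
  by apply: (@tychonoff nat (fun=> R) (fun=> `[0%R, (1 : R)]%classic)) => i;
    exact: segment_compact.
have FA : (G @ \oo) A.
  exists 0%N => // m _ i.
  by have := conj (G_ge0 m i) (G_le1 m i); rewrite /= in_itv /= => /andP.
have [p [Ap clp]] := cA (G @ \oo) _ FA.
have p0 j : 0 <= p j by have := Ap j; rewrite /= in_itv /= => /andP[].
exists p; split=> // [m|m a a0].
  rewrite -lerN2.
  have -> : - (\sum_(j < m) p j `^ k) = - (\sum_(j < m) `|p j| `^ k).
    by congr (- _); apply: eq_bigr => j _; rewrite ger0_norm.
  apply: (@cluster_ge seqs (G @ \oo) _
    (fun H : seqs => - (\sum_(j < m) `|H j| `^ k))) clp.
    move=> x; have h := @continuous_sum_powR k m k1 x.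
    exact: (cvgN h).
  exists m => // m' /= mm'; rewrite lerN2.
  have [_ S1 _] := hG0 m'; apply: le_trans S1.
  rewrite -(subnKC mm') big_split_ord /= -[leLHS]addr0 lerD //; last first.
    by apply: sumr_ge0 => i _; exact: powR_ge0.
  apply: ler_sum => j _; rewrite ger0_norm ?G_ge0 //.
  by rewrite /G (leq_trans (ltn_ord j)) // subnKC // leq_addr.
have Phi_ge e : 0 < e -> N m a `^ s - e <=
    B * \sum_(j < m) (`|p j + a j ^+ 2| `^ k - `|p j| `^ k).
  move=> ep; apply: (@cluster_ge seqs (G @ \oo) _
    (fun H : seqs => B * \sum_(j < m) (`|H j + a j ^+ 2| `^ k - `|H j| `^ k))) clp.
    move=> x; have h := @continuous_sum_coords k (fun j => a j ^+ 2) m k1 x.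
    exact: (cvgM (cvg_cst B) h).
  have : \forall n \near \oo, n.+1%:R^-1 < e by exact: near_infty_natSinv_lt (PosNum ep).
  move=> [n0 _ hn0]; exists (maxn m n0) => // m' /=; rewrite geq_max => /andP[mm' nm'].
  have [G00 _ /(_ a)] := hG0 m'.
  rewrite (NE m m' a mm' a0) => h.
  have he := hn0 m' nm'.
  have E : \sum_(j < m') ((G0 m' j + a j ^+ 2) `^ k - G0 m' j `^ k) =
    \sum_(j < m) (`|G m' j + a j ^+ 2| `^ k - `|G m' j| `^ k).
    rewrite -(subnKC mm') big_split_ord /= addrC big1 ?add0r => [|i _]; last first.
      by rewrite a0 ?leq_addr // expr0n addr0 subrr.
    apply: eq_bigr => j _.
    rewrite !ger0_norm ?addr_ge0 ?sqr_ge0 ?G_ge0 //.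
    by rewrite /G (leq_trans (ltn_ord j)) // subnKC // leq_addr.
  by rewrite /= -E lerBlDr (le_trans h) // addrC lerD2l; exact: ltW.
rewrite -subr_le0 leNgt; apply/negP => gt0.
have E : \sum_(j < m) (`|p j + a j ^+ 2| `^ k - `|p j| `^ k) =
    \sum_(j < m) ((p j + a j ^+ 2) `^ k - p j `^ k).
  by apply: eq_bigr => j _; rewrite !ger0_norm ?addr_ge0 ?sqr_ge0.
by have := Phi_ge _ (divr_gt0 gt0 (ltr0n R 2)); rewrite E; lra.
Qed.

End Limit.

(** * Moments of dominated densities *)

Section Moments.
Variable R : realType.
Implicit Types (k s p K : R) (d g h : nat -> R).

Lemma powR_1D_le k : 0 <= k ->
  exists2 M, 0 <= M & forall y, 0 <= y <= 1 -> (1 + y) `^ k - 1 <= M * y.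
Proof.
move=> k0; pose n := (Num.truncn k).+1.
exists (2 ^+ n) => [|y /andP[y0 y1]]; first by rewrite exprn_ge0.
apply: (@le_trans _ _ ((1 + y) ^+ n - 1)).
  rewrite lerD2r -powR_mulrn ?addr_ge0 // ler_powR ?lerDl //.
  exact/ltW/truncnS_gt.
suff : (1 + y) ^+ n <= 1 + (2 ^+ n - 1) * y by lra.
elim: n => [|n IH]; first by rewrite !expr0; lra.
have p1 : 1 <= 2 ^+ n :> R by rewrite exprn_ege1 // ler1n.
rewrite !exprS; set u := 2 ^+ n in IH p1 *; set v := (1 + y) ^+ n in IH *.
have := ler_wpM2l (_ : 0 <= 1 + y) IH; rewrite addr_ge0 // => /(_ isT).
have : 0 <= (u - 1) * (y * (1 - y)) by rewrite !mulr_ge0 // ?subr_ge0.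
lra.
Qed.

(** The density g is dominated if integration against it on functions with values in
[0, 1] is bounded by the L_2 norm for d to the power 2/s.  For s = 2 this is a bound
of g in L_2; for s > 2 it is a restricted weak-type condition. *)
Definition dominated s K m d g :=
  [/\ forall j, 0 <= d j, forall j, 0 <= g j, \sum_(j < m) d j <= 1 &
   forall h, (forall j, 0 <= h j <= 1) ->
     (\sum_(j < m) d j * g j * h j) `^ s <= K * \sum_(j < m) d j * h j ^+ 2].

(** Test on h = g / G with G an upper bound of g: the homogeneity of the case s = 2
makes G disappear.  Moments of order p <= 2 follow from g^p <= 1 + g^2. *)
Lemma dominated_moment2 p K : 0 <= K -> 1 <= p <= 2 ->
  exists C, forall m d g, dominated 2 K m d g ->
    \sum_(j < m) d j * g j `^ p <= C.
Proof.
move=> K0 /andP[p1 p2]; exists (1 + K) => m d g [d0 g0 d1 dom].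
pose G := 1 + \sum_(j < m) g j.
have G0 : 0 < G by rewrite ltr_pwDl // sumr_ge0.
have gG (j : 'I_m) : g j <= G.
  rewrite /G (bigD1 j) //= addrCA lerDl addr_ge0 // sumr_ge0 //.
pose h j := if (j < m)%N then g j / G else 0.
set A := \sum_(j < m) d j * g j ^+ 2.
have A0 : 0 <= A by apply: sumr_ge0 => j _; rewrite mulr_ge0 ?sqr_ge0.
have AK : A <= K.
  have := dom h.
  have -> : \sum_(j < m) d j * g j * h j = A / G.
    rewrite /A mulr_suml; apply: eq_bigr => j _.
    by rewrite /h ltn_ord expr2 !mulrA.
  have -> : \sum_(j < m) d j * h j ^+ 2 = A / G ^+ 2.
    rewrite /A mulr_suml; apply: eq_bigr => j _.
    by rewrite /h ltn_ord expr_div_n mulrA.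
  rewrite powR_mulrn ?(divr_ge0 A0 (ltW G0)) // expr_div_n mulrA ler_pM2r ?invr_gt0 ?exprn_gt0 //.
  have hh j : 0 <= h j <= 1.
    rewrite /h; case: ifP => jm; last by rewrite lexx ler01.
    by rewrite divr_ge0 ?(ltW G0) //= ler_pdivrMr // mul1r (gG (Ordinal jm)).
  move=> /(_ hh) AA; have [->//|AN0] := eqVneq A 0.
  have Ap : 0 < A by rewrite lt0r AN0.
  by move: AA; rewrite expr2 ler_pM2r.
apply: (@le_trans _ _ (\sum_(j < m) d j + A)); last by rewrite lerD.
rewrite -big_split /=; apply: ler_sum => j _.
rewrite -[X in X + _]mulr1 -mulrDr ler_wpM2l //.
have [g1|g1] := leP (g j) 1.
  have : g j `^ p <= 1 `^ p by rewrite ge0_ler_powR ?nnegrE //; lra.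
  by rewrite powR1; have := sqr_ge0 (g j); lra.
have : g j `^ p <= g j `^ 2 by rewrite ler_powR // ltW.
by rewrite powR_mulrn //; lra.
Qed.

Lemma sum_geometric_le (t : R) L : 0 <= t -> t < 1 ->
  \sum_(l < L) t ^+ l <= (1 - t)^-1.
Proof.
move=> t0 t1; have := subrX1 t L.
rewrite -div1r ler_pdivlMr ?subr_gt0 // => E.
have -> : (\sum_(l < L) t ^+ l) * (1 - t) = 1 - t ^+ L by lra.
by have := exprn_ge0 L t0; lra.
Qed.

Lemma powR_le_dyadic (x q : R) L : 0 <= q -> 0 <= x -> x <= 2 ^+ L ->
  x `^ q <= 1 + \sum_(l < L) (2 ^+ l.+1) `^ q * (2 ^+ l < x)%R%:R.
Proof.
move=> q0 x0; elim: L => [|L IH] xL.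
  rewrite big_ord0 addr0; have : x `^ q <= 1 `^ q.
    by rewrite ge0_ler_powR ?nnegrE // (le_trans xL) // expr0.
  by rewrite powR1.
rewrite big_ord_recr /=; have [xle|xgt] := leP x (2 ^+ L).
  by rewrite mulr0 addr0 IH.
rewrite mulr1.
have : x `^ q <= (2 ^+ L.+1) `^ q by rewrite ge0_ler_powR ?nnegrE ?exprn_ge0.
have : 0 <= \sum_(l < L) (2 ^+ l.+1) `^ q * (2 ^+ l < x)%R%:R.
  by apply: sumr_ge0 => l _; rewrite mulr_ge0 ?powR_ge0.
lra.
Qed.

Lemma exists_pow2 (x : R) : exists L, x <= 2 ^+ L.
Proof.
exists (Num.truncn x).+1.
apply: (le_trans (ltW (truncnS_gt x))).
by rewrite -natrX ler_nat ltnW // ltn_expl.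
Qed.

(** Testing on the indicator of the set where g exceeds lam gives I^s <= K d(g > lam)
for the integral I of g over this set, and lam d(g > lam) <= I by Chebyshev's
inequality. *)
Lemma dominated_weak_type s K m d g (lam : R) : 1 < s -> 0 <= K -> 0 < lam ->
  dominated s K m d g ->
  \sum_(j < m) d j * g j * (lam < g j)%R%:R <= (K / lam) `^ (s - 1)^-1.
Proof.
move=> s1 K0 l0 [d0 g0 d1 dom].
set I := \sum_(j < m) _.
have I0 : 0 <= I by apply: sumr_ge0 => j _; rewrite !mulr_ge0.
have [->|IN0] := eqVneq I 0; first exact: powR_ge0.
have Ip : 0 < I by rewrite lt0r IN0.
have Is : I `^ s <= K * (I / lam).
  have := dom (fun j => (lam < g j)%R%:R) => /(_ (fun j => _)) h.
  apply: le_trans (h _) _ => [j|]; first by case: ltP; rewrite /= ?lexx ?ler01.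
  rewrite ler_wpM2l // ler_pdivlMr // mulr_suml; apply: ler_sum => j _.
  case: ltP => /= lg; rewrite ?expr1n ?expr0n /= ?mulr0 ?mul0r //.
  by rewrite !mulr1 ler_wpM2l // ltW.
have s10 : 0 < s - 1 by rewrite subr_gt0.
have : I `^ (s - 1) <= K / lam.
  have Es : I `^ s = I * I `^ (s - 1).
    by rewrite mulr_powRB1 // (lt_trans ltr01).
  by move: Is; rewrite Es mulrCA ler_pM2l.
move=> h.
have -> : I = (I `^ (s - 1)) `^ (s - 1)^-1.
  by rewrite -powRrM divff ?gt_eqF // powRr1.
by rewrite ge0_ler_powR ?nnegrE ?invr_ge0 ?powR_ge0 ?divr_ge0 // ltW.
Qed.

(** Decompose g^(p-1) over the dyadic level sets of g.  By the weak-type bound the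
contribution of level l decays like 2^(l (p-1-1/(s-1))), and the exponent is
negative exactly when p is smaller than the conjugate exponent of s. *)
Lemma dominated_moment s p K : 1 < s -> 0 <= K -> 1 <= p -> (p - 1) * (s - 1) < 1 ->
  exists C, forall m d g, dominated s K m d g ->
    \sum_(j < m) d j * g j `^ p <= C.
Proof.
move=> s1 K0 p1 ps.
have s10 : 0 < s - 1 by rewrite subr_gt0.
pose c := (s - 1)^-1; pose q := p - 1.
have q0 : 0 <= q by rewrite subr_ge0.
have qc : q < c by rewrite /c -div1r ltr_pdivlMr.
pose t : R := 2 `^ (q - c).
have t0 : 0 <= t by exact: powR_ge0.
have t1 : t < 1.
  have l2 : 0 < ln (2 : R) by rewrite ln_gt0 ?ltr1n.
  rewrite /t /powR gt_eqF // -[ltRHS]expR0 ltr_expR.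
  by rewrite nmulr_rlt0 // subr_lt0.
exists ((1 + K) + 2 `^ q * K `^ c * (1 - t)^-1) => m d g dom.
have [d0 g0 d1 domh] := dom.
have [L hL] := exists_pow2 (\sum_(j < m) g j).
have gL (j : 'I_m) : g j <= 2 ^+ L.
  by apply: le_trans hL; rewrite (bigD1 j) //= lerDl sumr_ge0.
have dg : \sum_(j < m) d j * g j <= 1 + K.
  have h01 (j : nat) : 0 <= (1 : R) <= 1 by rewrite ler01 lexx.
  have := domh (fun=> 1) h01.
  under eq_bigr do rewrite mulr1; under [X in K * X]eq_bigr do rewrite expr1n mulr1.
  set Z := \sum_(j < m) d j * g j => h.
  have [Z1|Z1] := leP Z 1; first by rewrite (le_trans Z1) // lerDl.
  apply: (le_trans (le1r_powR (ltW Z1) (ltW s1))); apply: (le_trans h).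
  by rewrite (@le_trans _ _ (K * 1)) ?ler_wpM2l // mulr1 lerDr.
apply: (@le_trans _ _ (\sum_(j < m) (d j * g j + d j * g j *
    \sum_(l < L) (2 ^+ l.+1) `^ q * (2 ^+ l < g j)%R%:R))).
  apply: ler_sum => j _.
  rewrite -mulr_powRB1 ?(lt_le_trans ltr01) // mulrA -{2}[d j * g j]mulr1 -mulrDr.
  by rewrite ler_wpM2l ?mulr_ge0 // powR_le_dyadic.
rewrite big_split /= lerD //.
under eq_bigr do rewrite mulr_sumr.
rewrite exchange_big /=.
apply: le_trans (_ : 2 `^ q * K `^ c * \sum_(l < L) t ^+ l <= _); last first.
  by rewrite ler_wpM2l ?mulr_ge0 ?powR_ge0 // sum_geometric_le.
rewrite mulr_sumr; apply: ler_sum => l _.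
under eq_bigr do rewrite mulrCA.
rewrite -mulr_sumr.
have l0 : 0 < 2 ^+ l :> R by rewrite exprn_gt0.
apply: le_trans (ler_wpM2l (powR_ge0 _ _) (dominated_weak_type s1 K0 l0 dom)) _.
rewrite -/c -/(K / _) powRM ?invr_ge0 ?(ltW l0) // mulrCA [leRHS]mulrAC.
rewrite [leLHS]mulrC ler_wpM2r ?powR_ge0 //.
rewrite exprS powRM ?exprn_ge0 // -mulrA ler_wpM2l ?powR_ge0 //.
have -> : (2 ^- l) `^ c = (2 ^+ l) `^ (- c) :> R.
  by rewrite -powR_inv1 ?(ltW l0) // -powRrM mulN1r.
rewrite -powRD; last by rewrite (gt_eqF l0) implybT.
by rewrite -powR_mulrn // -powRrM mulrC powRrM powR_mulrn.
Qed.

End Moments.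

(** * Sequences and their linear combinations *)

Section Sequences.
Variables (R : realType).

(** Summability is used throughout in the form of bounded partial sums. *)
Lemma nneseries_bounded (u : nat -> R) : (forall j, 0 <= u j) ->
  (\sum_(0 <= j <oo) (u j)%:E < +oo)%E <->
  exists W, forall m, \sum_(j < m) u j <= W.
Proof.
move=> u0; split=> [h|[W hW]].
  exists (fine (\sum_(0 <= j <oo) (u j)%:E)%E) => m.
  rewrite -lee_fin fineK ?ge0_fin_numE ?nneseries_ge0 // => [|j _ _]; last by rewrite lee_fin.
  rewrite -sumEFin -(big_mkord xpredT (fun j => (u j)%:E)).
  by apply: nneseries_lim_ge => j _ _; rewrite lee_fin.
apply: (@le_lt_trans _ _ W%:E); last exact: ltry.
apply: lime_le; first by apply: is_cvg_nneseries => j _ _; rewrite lee_fin.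
apply: nearW => m; rewrite big_mkord sumEFin lee_fin //.
Qed.

End Sequences.

Section Weak.
Variables (R : realType) (K : scalar_kind) (X : normedModType (scalar R K)).
Implicit Types (x : nat -> X) (a : nat -> R).

Lemma ellP p x : ell p x <->
  exists W, forall m, \sum_(j < m) rnorm (x j) `^ p <= W.
Proof. by apply: nneseries_bounded => j; exact: powR_ge0. Qed.

Lemma weak_ellP q x : weak_ell q%:E x <->
  exists W, forall phi, dual_ball X phi ->
    forall m, \sum_(j < m) rnorm (phi (x j)) `^ q <= W.
Proof.
split=> [h|[W hW]]; last first.
  apply: (@le_lt_trans _ _ W%:E); last exact: ltry.
  apply: ge_ereal_sup => _ [phi Bphi <-].
  apply: lime_le.
    by apply: is_cvg_nneseries => j _ _; rewrite lee_fin powR_ge0.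
  by apply: nearW => m; rewrite big_mkord sumEFin lee_fin hW.
move: h; rewrite /weak_ell /mkset; set S := ereal_sup _ => h.
exists (fine S) => phi Bphi m.
have hS : ((\sum_(j < m) rnorm (phi (x j)) `^ q)%:E <= S)%E.
  apply: (@le_trans _ _ (\sum_(0 <= j <oo) (rnorm (phi (x j)) `^ q)%:E)%E).
    rewrite -sumEFin -(big_mkord xpredT (fun j => (rnorm (phi (x j)) `^ q)%:E)).
    by apply: nneseries_lim_ge => j _ _; rewrite lee_fin powR_ge0.
  by apply: ereal_sup_ubound; exists phi.
rewrite -lee_fin fineK // fin_numE; apply/andP; split.
  by apply/eqP => E; rewrite E leeNy_eq in hS.
by rewrite lt_eqF.
Qed.

(** Real coefficients only: this is the operator on real sequences whose
factorization is studied. *)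
Definition comb x m a : X := \sum_(j < m) emb K (a j) *: x j.

Lemma comb_norming x m a (c : R) :
  (forall phi, dual_ball X phi ->
     \sum_(j < m) `|a j| * rnorm (phi (x j)) <= c) ->
  rnorm (comb x m a) <= c.
Proof.
move=> h; have [phi Bphi <-] := norming_functional (comb x m a).
apply: le_trans (h _ Bphi).
apply: le_trans (ler_norm _) _; apply: le_trans (real_part_le_rnorm _) _.
rewrite /comb linear_sum; apply: le_trans (rnorm_sum _ _ _) _.
by apply: ler_sum => j _; rewrite linearZ /= rnorm_emb.
Qed.

(** Young's inequality, applied to each term of the norming functional, is enough at
this scale; homogeneity gives the general bound. *)
Lemma comb_bounded x r rho : 0 < r -> 0 < rho -> rho^-1 + r^-1 = 1 ->
  weak_ell r%:E x ->
  exists2 W, 0 <= W & forall m a, \sum_(j < m) `|a j| `^ rho <= 1 ->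
    rnorm (comb x m a) <= W.
Proof.
move=> r0 rho0 conj /weak_ellP[W hW].
exists (1 + `|W|) => [|m a ha]; first by rewrite addr_ge0.
have r1 : r^-1 <= 1 by rewrite -conj lerDr invr_ge0 ltW.
have rho1 : rho^-1 <= 1 by rewrite -conj lerDl invr_ge0 ltW.
apply: (@comb_norming x m a (1 + `|W|)) => phi Bphi.
apply: le_trans (_ : \sum_(j < m) (`|a j| `^ rho + rnorm (phi (x j)) `^ r) <= _).
  apply: ler_sum => j _.
  apply: (le_trans (conjugate_powR _ (rnorm_ge0 _) rho0 r0 conj)) => //.
  by rewrite lerD // ler_piMr ?powR_ge0.
rewrite big_split lerD //.
exact: le_trans (hW _ Bphi m) (ler_norm _).
Qed.

Lemma combZ x m (c : R) a : comb x m (fun j => c * a j) = emb K c *: comb x m a.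
Proof.
by rewrite /comb scaler_sumr; apply: eq_bigr => j _; rewrite embM scalerA.
Qed.

Lemma comb_sum x m n (c : 'I_n -> R) (f : 'I_n -> nat -> R) :
  \sum_(i < n) emb K (c i) *: comb x m (f i) =
  comb x m (fun j => \sum_(i < n) c i * f i j).
Proof.
rewrite /comb; under eq_bigr do rewrite scaler_sumr.
rewrite exchange_big; apply: eq_bigr => j _ /=.
under eq_bigr do rewrite scalerA -embM.
rewrite -scaler_suml; congr (_ *: _).
by elim/big_ind2: _ => [|u1 v1 u2 v2 -> ->|i _]; rewrite ?emb0 ?embD.
Qed.

(** A bound linear in the sum of the rho-th powers can be averaged over signs term by
term, unlike the sharp one, which raises this sum to the power 2/rho; the price is
the added 1. *)
Lemma comb_sqr_le x r rho : 0 < r -> 2 <= rho -> rho^-1 + r^-1 = 1 ->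
  weak_ell r%:E x ->
  exists2 W, 0 <= W & forall m a,
    rnorm (comb x m a) ^+ 2 <= W ^+ 2 * (1 + \sum_(j < m) `|a j| `^ rho).
Proof.
move=> r0 rho2 conj wx; have rho0 : 0 < rho by lra.
have [W W0 hW] := comb_bounded r0 rho0 conj wx; exists W => // m a.
set S := \sum_(j < m) _.
have S0 : 0 <= S by apply: sumr_ge0 => j _; exact: powR_ge0.
have G1 : 1 <= 1 + S by rewrite lerDl.
pose c := (1 + S) `^ (- rho^-1).
have c0 : 0 < c by rewrite powR_gt0 // (lt_le_trans ltr01).
have crho : c `^ rho = (1 + S)^-1.
  by rewrite -powRrM mulNr mulVf ?gt_eqF // powR_inv1 // (le_trans ler01).
have := hW m (fun j => c * a j).
have -> : \sum_(j < m) `|c * a j| `^ rho = (1 + S)^-1 * S.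
  rewrite -crho /S mulr_sumr; apply: eq_bigr => j _.
  by rewrite normrM gtr0_norm // powRM // ltW.
rewrite ler_pdivrMl ?(lt_le_trans ltr01) // mulr1 lerDr ler01 => /(_ isT).
rewrite combZ rnorm_emb gtr0_norm // => h.
have c2 : 1 <= c ^+ 2 * (1 + S).
  rewrite -powR_mulrn ?(ltW c0) // -powRrM -{2}[1 + S]powRr1 ?(le_trans ler01) //.
  rewrite -powRD; last by rewrite (gt_eqF (lt_le_trans ltr01 G1)) implybT.
  have e0 : 0 <= - rho^-1 * 2 + 1.
    by rewrite mulNr addrC subr_ge0 mulrC ler_pdivrMr // mul1r.
  by rewrite -[leLHS](powRr0 (1 + S)) ler_powR.
have := rnorm_ge0 (comb x m a); set v := rnorm _ in h * => v0.
have h2 : (c * v) ^+ 2 <= W ^+ 2.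
  by rewrite ler_sqr ?nnegrE // mulr_ge0 // ltW.
apply: (@le_trans _ _ ((c * v) ^+ 2 * (1 + S))); last first.
  by rewrite ler_wpM2r // (le_trans ler01).
by rewrite exprMn mulrAC ler_peMl // sqr_ge0.
Qed.

(** Averaging [comb_sqr_le] over the signs reduces the claim to Khinchin's inequality
in each coordinate j. *)
Lemma rademacher_mean_comb x r rho : 0 < r -> 2 <= rho -> rho^-1 + r^-1 = 1 ->
  weak_ell r%:E x ->
  exists2 B, 0 <= B & forall m n (f : 'I_n -> nat -> R),
    \sum_(j < m) (\sum_(i < n) f i j ^+ 2) `^ (rho / 2) <= 1 ->
    rademacher_mean (fun i => comb x m (f i)) <= B.
Proof.
move=> r0 rho2 conj wx.
have rho0 : 0 < rho by lra.
have [W W0 hW] := comb_sqr_le r0 rho2 conj wx.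
have [c c0 hc] := khinchin rho0.
exists (Num.sqrt (W ^+ 2 * (1 + c))) => [|m n f hf]; first exact: sqrtr_ge0.
rewrite /rademacher_mean ler_wsqrtr // ler_pdivrMl ?exprn_gt0 //.
apply: (@le_trans _ _ (\sum_(eps : {ffun 'I_n -> bool})
   W ^+ 2 * (1 + \sum_(j < m) `|\sum_(i < n) (-1) ^+ eps i * f i j| `^ rho))).
  apply: ler_sum => eps _.
  under eq_bigr do rewrite -(@emb_sign R K).
  by rewrite comb_sum hW.
rewrite -mulr_sumr mulrCA ler_wpM2l ?sqr_ge0 // big_split /=.
rewrite mulrDr lerD //.
  by rewrite sumr_const card_ffun card_bool card_ord natrX mulr1.
rewrite exchange_big /= -ler_pdivrMl ?exprn_gt0 // mulr_sumr.
apply: (@le_trans _ _ (c * \sum_(j < m) (\sum_(i < n) f i j ^+ 2) `^ (rho / 2))).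
  by rewrite mulr_sumr; apply: ler_sum => j _; exact: hc.
by rewrite ler_piMr // ltW.
Qed.

Lemma cotype_sum_le s (C B : R) m (y : 'I_m -> X) : 0 < s -> 0 <= B ->
  (\sum_(j < m) rnorm (y j) `^ s) `^ s^-1 <= C * rademacher_mean y ->
  rademacher_mean y <= B ->
  \sum_(j < m) rnorm (y j) `^ s <= (`|C| * B) `^ s.
Proof.
move=> s0 B0 h1 h2; set S := \sum_(j < m) _ in h1 *.
have S0 : 0 <= S by apply: sumr_ge0 => j _; exact: powR_ge0.
have -> : S = (S `^ s^-1) `^ s by rewrite -powRrM mulVf ?gt_eqF // powRr1.
rewrite ge0_ler_powR ?nnegrE ?powR_ge0 ?mulr_ge0 ?(ltW s0) //.
apply: (le_trans h1); apply: (@le_trans _ _ (`|C| * rademacher_mean y)).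
  by rewrite ler_wpM2r ?sqrtr_ge0 // ler_norm.
by rewrite ler_wpM2l.
Qed.

End Weak.

(** * Diagonal factorization of weakly summable sequences *)

Section Factor.
Variables (R : realType) (K : scalar_kind) (X : normedModType (scalar R K)).
Implicit Types (x : nat -> X) (a : nat -> R).

Lemma comb_widen x m m' a : (m <= m')%N -> (forall j, (m <= j)%N -> a j = 0) ->
  comb x m' a = comb x m a.
Proof.
move=> mm' a0; rewrite /comb -(subnKC mm') big_split_ord /= addrC big1 ?add0r //.
by move=> j _; rewrite a0 ?leq_addr // emb0 scale0r.
Qed.

Lemma sum_delta (V : zmodType) (f : nat -> V) (j : nat) : (forall i, i != j -> f i = 0) ->
  \sum_(i < j.+1) f i = f j.
Proof.
move=> f0; rewrite (bigD1 (@ord_max j)) //= big1 ?addr0 // => i.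
by rewrite -val_eqE; exact: f0.
Qed.

(** The near-extremal weights of [extremal_family] for N = ||sum_j a_j x_j||, in the
limit.  If F_j = 0, the inequality for a multiple eta of the j-th unit vector reads
||eta x_j||^s <= B eta^rho, and s < rho forces x_j = 0. *)
Lemma exists_weights x s r rho : has_cotype s X -> 2 <= s -> s < rho ->
  0 < r -> rho^-1 + r^-1 = 1 -> weak_ell r%:E x ->
  exists (F : nat -> R) (M : R), [/\ 0 <= M, forall j, 0 <= F j,
    forall m, \sum_(j < m) F j `^ rho <= 1,
    forall j, F j = 0 -> x j = 0 &
    forall m h, (forall j, `|h j| <= 1) ->
      rnorm (comb x m (fun j => h j * F j)) `^ s <=
      M * \sum_(j < m) F j `^ rho * h j ^+ 2].
Proof.
move=> [C hC] s2 srho r0 conj wx.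
have s0 : 0 < s by lra.
have rho2 : 2 <= rho by lra.
have rho0 : 0 < rho by lra.
have [B1 B10 hB1] := rademacher_mean_comb r0 rho2 conj wx.
pose B := (`|C| * B1) `^ s.
have B0 : 0 <= B by exact: powR_ge0.
have k1 : 1 <= rho / 2 by lra.
have [|m e e0|G [G0 G1 hG]] := @limit_weights R (fun m a => rnorm (comb x m a)) (rho / 2) s B k1 B0.
- by move=> m m' a mm' a0; rewrite (comb_widen x mm' a0).
- apply: extremal_family => //; first exact: ltW.
  + by move=> a; exact: rnorm_ge0.
  + by move=> c a c0; rewrite combZ rnorm_emb ger0_norm.
  + move=> n f hf; apply: (@cotype_sum_le R K X s C B1) => //.
    exact: hB1.
have [M M0 hM] := @powR_1D_le R (rho / 2) (le_trans ler01 k1).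
pose F j := Num.sqrt (G j).
have F0 j : 0 <= F j by exact: sqrtr_ge0.
have FG j : F j `^ rho = G j `^ (rho / 2).
  by rewrite /F -powR12_sqrt // -powRrM mulrC.
have F2 j : F j ^+ 2 = G j by rewrite sqr_sqrtr.
exists F, (B * M); split; first exact: mulr_ge0.
- by [].
- by move=> m; under eq_bigr do rewrite FG.
- move=> j Fj; apply: rnorm0_eq0; apply/eqP; apply/negPn/negP => vN0.
  set v := rnorm (x j) in vN0.
  have v0 : 0 < v by rewrite lt0r vN0 rnorm_ge0.
  have d0 : 0 < rho - s by rewrite subr_gt0.
  have B1p : 0 < B + 1 by lra.
  (* Chosen so that B eta^(rho - s) < v^s. *)
  pose eta := (v `^ s / (B + 1)) `^ (rho - s)^-1.
  have eta0 : 0 < eta by rewrite powR_gt0 // divr_gt0 // powR_gt0.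
  have etaE : eta `^ (rho - s) = v `^ s / (B + 1).
    by rewrite -powRrM mulVf ?gt_eqF // powRr1 // divr_ge0 ?powR_ge0 // ltW.
  pose a i := if i == j then eta else 0.
  have := hG j.+1 a; have a0 i : (j.+1 <= i)%N -> a i = 0.
    by rewrite /a; case: eqP => // ->; rewrite ltnn.
  move=> /(_ a0); rewrite /comb.
  rewrite (@sum_delta _ (fun i => emb K (a i) *: x i)); last first.
    by move=> i ij; rewrite /a (negbTE ij) emb0 scale0r.
  rewrite (@sum_delta _ (fun i => (G i + a i ^+ 2) `^ (rho / 2) - G i `^ (rho / 2))); last first.
    by move=> i ij; rewrite /a (negbTE ij) expr0n addr0 subrr.
  rewrite /a eqxx rnorm_emb gtr0_norm // -(F2 j) Fj expr0n add0r.
  rewrite (@powR0 _ (rho / 2)) ?gt_eqF ?divr_gt0 // subr0 -/v.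
  rewrite powRM ?(ltW eta0) ?(ltW v0) // -powR_mulrn ?(ltW eta0) // -powRrM.
  have -> : 2%:R * (rho / 2) = s + (rho - s) by field.
  rewrite powRD; last by rewrite (gt_eqF eta0) implybT.
  have es0 : 0 < eta `^ s by exact: powR_gt0.
  have vs0 : 0 < v `^ s by exact: powR_gt0.
  rewrite etaE mulrCA (ler_pM2l es0) mulrA ler_pdivlMr // mulrC.
  by rewrite (ler_pM2r vs0) gerDl ler10.
- move=> m h h1.
  pose a j := if (j < m)%N then h j * F j else 0.
  have -> : comb x m (fun j => h j * F j) = comb x m a.
    by apply: eq_bigr => j _; rewrite /a ltn_ord.
  have a0 j : (m <= j)%N -> a j = 0 by rewrite /a leqNgt; case: ltnP.
  apply: (le_trans (hG m a a0)); rewrite -mulrA ler_wpM2l //.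
  rewrite mulr_sumr; apply: ler_sum => j _.
  rewrite /a ltn_ord exprMn F2 FG.
  have h2 : 0 <= h j ^+ 2 <= 1.
    by rewrite sqr_ge0 /= -real_normK ?num_real // expr_le1.
  have -> : G j + h j ^+ 2 * G j = (1 + h j ^+ 2) * G j by ring.
  rewrite powRM //; last by rewrite addr_ge0 // sqr_ge0.
  have := ler_wpM2l (powR_ge0 (G j) (rho / 2)) (hM _ h2).
  lra.
Qed.

(** The quasi-triangle inequality, used to recombine the two real parts of a
functional. *)
Lemma powRD_le (u v p : R) : 0 <= u -> 0 <= v -> 0 < p ->
  (u + v) `^ p <= 2 `^ p * (u `^ p + v `^ p).
Proof.
move=> u0 v0 p0.
wlog uv : u v u0 v0 / u <= v => [H|].
  by have [/H|/ltW/H] := leP u v; [apply | rewrite addrC [X in _ * X]addrC; apply].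
apply: (@le_trans _ _ ((2 * v) `^ p)).
  by rewrite ge0_ler_powR ?nnegrE ?(ltW p0) ?addr_ge0 ?mulr_ge0 //; lra.
by rewrite powRM // ler_wpM2l ?powR_ge0 // lerDr powR_ge0.
Qed.

(** With a_j = sgn (psi (x_j)) h_j F_j, the number psi (sum_j a_j x_j) is the integral of
h times the density |psi (x_j)| F_j^(1 - rho) against the weights F_j^rho. *)
Lemma dominated_functional x s rho M m (F : nat -> R) (psi : X -> R) :
  (forall j, 0 <= F j) -> 0 < s -> 0 < rho ->
  \sum_(j < m) F j `^ rho <= 1 ->
  (forall j, F j = 0 -> x j = 0) ->
  (forall h, (forall j, `|h j| <= 1) ->
      rnorm (comb x m (fun j => h j * F j)) `^ s <=
      M * \sum_(j < m) F j `^ rho * h j ^+ 2) ->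
  0 <= M ->
  (forall a, psi (comb x m a) = \sum_(j < m) a j * psi (x j)) ->
  (forall y, `|psi y| <= rnorm y) ->
  dominated s M m (fun j => F j `^ rho)
    (fun j => `|psi (x j)| * F j `^ (1 - rho)).
Proof.
move=> F0 s0 rho0 F1 Fx hF M0 psiL psi1; split=> // [j|j|h h01].
- exact: powR_ge0.
- by rewrite mulr_ge0 ?powR_ge0.
pose h' j := Num.sg (psi (x j)) * h j.
have h'1 j : `|h' j| <= 1.
  have /andP[hj0 hj1] := h01 j; rewrite normrM normr_sg ger0_norm //.
  by case: eqP => _; rewrite /= ?mul0r ?mul1r.
have -> : \sum_(j < m) F j `^ rho * (`|psi (x j)| * F j `^ (1 - rho)) * h j =
    psi (comb x m (fun j => h' j * F j)).
  rewrite psiL; apply: eq_bigr => j _.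
  have [Fj|FjN0] := eqVneq (F j) 0.
    by rewrite Fj powR0 ?gt_eqF // !mul0r mulr0 mul0r.
  have EF : F j `^ rho * F j `^ (1 - rho) = F j.
    rewrite -powRD; last by rewrite FjN0 implybT.
    by rewrite addrC subrK powRr1.
  by rewrite mulrCA EF /h' normrEsg; ring.
apply: le_trans (_ : rnorm (comb x m (fun j => h' j * F j)) `^ s <= _).
  have := psi1 (comb x m (fun j => h' j * F j)).
  set v := psi _ => hv.
  have [v0|v0] := leP 0 v.
    by rewrite ge0_ler_powR ?nnegrE ?rnorm_ge0 ?(ltW s0) // (le_trans _ hv) // ler_norm.
  exfalso; move: v0; rewrite ltNge => /negP; apply.
  rewrite /v psiL; apply: sumr_ge0 => j _.
  rewrite /h' mulrAC mulr_ge0 // mulrAC -normrEsg mulr_ge0 //.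
  by case/andP: (h01 j).
apply: (le_trans (hF _ h'1)); rewrite ler_wpM2l // ler_sum // => j _.
rewrite ler_wpM2l ?powR_ge0 // /h' exprMn ler_piMl ?sqr_ge0 //.
by rewrite -real_normK ?num_real // normr_sg; case: eqP; rewrite ?expr0n ?expr1n.
Qed.

Lemma real_part_comb (phi : {linear X -> (scalar R K)^o}) (k : scalar R K) x m a :
  real_part (k * phi (comb x m a)) = \sum_(j < m) a j * real_part (k * phi (x j)).
Proof.
rewrite /comb linear_sum mulr_sumr.
elim/big_ind2: _ => [|u1 v1 u2 v2 <- <-|j _].
- by rewrite -(emb0 R K) real_partK.
- by rewrite real_partD.
- by rewrite linearZ /= mulrCA real_part_emb.
Qed.

Lemma sum_rnorm_le (phi : {linear X -> (scalar R K)^o}) p C1 C2 (w : nat -> R) x m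
    (k : scalar R K) : 0 < p ->
  (forall j, 0 <= w j) ->
  (forall z : scalar R K,
    rnorm (z : (scalar R K)^o) <= `|real_part z| + `|real_part (k * z)|) ->
  \sum_(j < m) (w j * `|real_part (phi (x j))|) `^ p <= C1 ->
  \sum_(j < m) (w j * `|real_part (k * phi (x j))|) `^ p <= C2 ->
  \sum_(j < m) rnorm (phi (emb K (w j) *: x j)) `^ p <= 2 `^ p * (C1 + C2).
Proof.
move=> p0 w0 hk h1 h2.
apply: (@le_trans _ _ (2 `^ p *
  (\sum_(j < m) (w j * `|real_part (phi (x j))|) `^ p +
   \sum_(j < m) (w j * `|real_part (k * phi (x j))|) `^ p))); last first.
  by rewrite ler_wpM2l ?powR_ge0 // lerD.
rewrite -big_split /= mulr_sumr; apply: ler_sum => j _.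
have wn (v : R) : 0 <= w j * `|v| by rewrite mulr_ge0.
apply: le_trans (powRD_le (wn _) (wn _) p0).
rewrite linearZ /= rnorm_emb ger0_norm //.
rewrite ge0_ler_powR ?nnegrE ?mulr_ge0 ?rnorm_ge0 ?addr_ge0 ?(ltW p0) //.
by rewrite -mulrDr ler_wpM2l.
Qed.

(** The weights are w0 = F and w1 = F^e with e = -(1-theta)/theta.  Since
rho + (1 - rho) p = e p, the p-th moment of the density of a functional psi is the
p-sum of w1 |psi (x_j)|.  Entries with F_j = 0 vanish and get weight 1. *)
Lemma weights_interpolation_gt1 x s p r theta : has_cotype s X -> 2 <= s ->
  0 < theta < 1 -> 1 < p ->
  (p - 1) * (s - 1) <= 1 -> (2 < s -> (p - 1) * (s - 1) < 1) ->
  r^-1 = (1 - theta) / 1 + theta / p -> weak_ell r%:E x ->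
  exists w0 w1 : nat -> R,
    [/\ forall j, 0 < w0 j, forall j, 0 < w1 j,
      forall j, w0 j `^ (1 - theta) * w1 j `^ theta = 1,
      ell s (fun j => emb K (w0 j) *: x j) &
      weak_ell p%:E (fun j => emb K (w1 j) *: x j)].
Proof.
move=> cot s2 /andP[th0 th1] p1 ps ps2 rE wx.
have s0 : 0 < s by lra.
have p0 : 0 < p by lra.
have q0 : 0 < p - 1 by rewrite subr_gt0.
pose rho := p / (theta * (p - 1)).
have tq0 : 0 < theta * (p - 1) by rewrite mulr_gt0.
have rho0 : 0 < rho by rewrite divr_gt0.
have srho : s < rho.
  rewrite /rho ltr_pdivlMr //.
  have : s * (p - 1) <= p by lra.
  have : 0 < (1 - theta) * (s * (p - 1)) by rewrite !mulr_gt0 // subr_gt0.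
  lra.
have ri0 : 0 < r^-1.
  by rewrite rE divr1 addr_gt0 ?subr_gt0 // divr_gt0.
have r0 : 0 < r by rewrite -invr_gt0.
have rhor : rho^-1 + r^-1 = 1.
  by rewrite rE /rho; field; rewrite !gt_eqF.
have [F [M [M0 F0 F1 Fx hF]]] := exists_weights cot s2 srho r0 rhor wx.
have [C hC] : exists C, forall m d g, dominated s M m d g ->
    \sum_(j < m) d j * g j `^ p <= C.
  move: s2; rewrite le_eqVlt => /predU1P[E|s2].
    have p2 : p <= 2 by move: ps; rewrite -E; lra.
    by rewrite -E; apply: dominated_moment2 => //; rewrite (ltW p1).
  by apply: dominated_moment => //; [lra | exact: ltW | exact: ps2].
pose e := - ((1 - theta) / theta).
have eE : rho + (1 - rho) * p = e * p.
  by rewrite /e /rho; field; rewrite !gt_eqF.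
pose w0 j := if F j == 0 then 1 else F j.
pose w1 j := if F j == 0 then 1 else F j `^ e.
have w0E j : emb K (w0 j) *: x j = emb K (F j) *: x j.
  by rewrite /w0; case: eqP => // /Fx ->; rewrite !scaler0.
have Fp j : F j != 0 -> 0 < F j by rewrite lt0r F0 andbT.
exists w0, w1; split.
- by move=> j; rewrite /w0; case: eqVneq => // /Fp.
- by move=> j; rewrite /w1; case: eqVneq => // /Fp; exact: powR_gt0.
- move=> j; rewrite /w0 /w1; case: eqVneq => [_|FjN0]; first by rewrite !powR1 mulr1.
  rewrite -powRrM -powRD; last by rewrite FjN0 implybT.
  by rewrite /e mulNr divfK ?gt_eqF // subrr powRr0.
- apply/ellP; exists M => m.
  apply: (@le_trans _ _ (M * \sum_(j < m) F j `^ rho)); last first.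
    by rewrite ler_piMr.
  rewrite mulr_sumr; apply: ler_sum => j _; rewrite w0E.
  pose h (i : nat) : R := (i == j)%:R.
  have h1 i : `|h i| <= 1 by rewrite /h; case: eqP; rewrite ?normr0 ?normr1.
  have := hF j.+1 h h1; rewrite /comb.
  rewrite (@sum_delta _ (fun i => emb K (h i * F i) *: x i)); last first.
    by move=> i /negbTE ij; rewrite /h ij mul0r emb0 scale0r.
  rewrite (@sum_delta _ (fun i => F i `^ rho * h i ^+ 2)); last first.
    by move=> i /negbTE ij; rewrite /h ij expr0n mulr0.
  by rewrite /h eqxx mul1r expr1n mulr1.
have [k k1 hk] := @exists_imag_unit R K.
have psi_bound (psi : X -> R) :
    (forall m a, psi (comb x m a) = \sum_(j < m) a j * psi (x j)) ->
    (forall y, `|psi y| <= rnorm y) ->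
    forall m, \sum_(j < m) (w1 j * `|psi (x j)|) `^ p <= C.
  move=> psiL psi1 m.
  have dom := dominated_functional F0 s0 rho0 (F1 m) Fx (hF m) M0 (psiL m) psi1.
  apply: le_trans (hC _ _ _ dom); apply: ler_sum => j _.
  have [Fj|FjN0] := eqVneq (F j) 0.
    have -> : psi (x j) = 0.
      by apply/eqP; rewrite -normr_le0 (le_trans (psi1 _)) // (Fx _ Fj) rnorm0.
    by rewrite normr0 mulr0 mul0r powR0 ?gt_eqF // mulr0.
  rewrite /w1 (negbTE FjN0) !powRM ?powR_ge0 // mulrCA mulrC ler_wpM2l ?powR_ge0 //.
  rewrite -!powRrM -powRD; last by rewrite FjN0 implybT.
  by rewrite eE.
apply/weak_ellP; exists (2 `^ p * (C + C)) => phi Bphi m.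
have w1p j : 0 <= w1 j.
  by rewrite /w1; case: ifP => // _; exact: powR_ge0.
apply: (@sum_rnorm_le phi p C C w1 x m k p0 w1p hk).
  apply: (psi_bound (fun y => real_part (phi y))) => [m' a|y].
    have := real_part_comb phi 1 x m' a; rewrite mul1r => ->.
    by apply: eq_bigr => j _; rewrite mul1r.
  exact: le_trans (real_part_le_rnorm _) (dual_ball_le _ Bphi).
apply: (psi_bound (fun y => real_part (k * phi y))) => [m' a|y].
  exact: real_part_comb.
apply: le_trans (real_part_le_rnorm _) _.
apply: le_trans (dual_ball_le y Bphi).
have -> : k * phi y = k *: (phi y : (scalar R K)^o) by [].
by rewrite rnormZ ler_piMl ?rnorm_ge0.
Qed.

(** All signed sums of a weakly 1-summable sequence are bounded, so cotype applies
directly. *)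
Lemma ell_of_weak_ell1 x s : has_cotype s X -> 0 < s -> weak_ell 1%:E x ->
  ell s x.
Proof.
move=> [C hC] s0 /weak_ellP[W hW]; apply/ellP; exists ((`|C| * `|W|) `^ s) => m.
apply: cotype_sum_le => //.
rewrite /rademacher_mean -[leRHS]ger0_norm // -sqrtr_sqr ler_wsqrtr //.
rewrite ler_pdivrMl ?exprn_gt0 //.
apply: le_trans (_ : \sum_(eps : {ffun 'I_m -> bool}) `|W| ^+ 2 <= _); last first.
  by rewrite sumr_const card_ffun card_bool card_ord -[leLHS]mulr_natl natrX.
apply: ler_sum => eps _; rewrite ler_sqr ?nnegrE ?rnorm_ge0 //.
have -> : \sum_(j < m) (-1) ^+ eps j *: x j =
    comb x m (fun j => if insub j is Some i then (-1) ^+ eps i else 0).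
  by apply: eq_bigr => j _; rewrite valK emb_sign.
apply: (@comb_norming _ _ _ x m _ `|W|) => phi Bphi.
apply: le_trans (le_trans (hW _ Bphi m) (ler_norm _)).
apply: ler_sum => j _; rewrite valK normrX normrN1 expr1n mul1r powRr1 //.
exact: rnorm_ge0.
Qed.

End Factor.

(** * Multilinear operators *)

Lemma cvg_prod_topology (I : Type) (T : I -> topologicalType) (S : Type)
    (G : set_system S) (FG : Filter G)
    (y : S -> prod_topology T) (t : prod_topology T) :
  (forall i, y N i @[N --> G] --> t i) -> y @ G --> t.
Proof.
move=> h; apply/cvg_sup => i A /= [_ [[B Bop <-] Bt sBA]].
have nB : nbhs (t i) B by apply: open_nbhs_nbhs.
exact: filterS (fun N => @sBA (y N)) (h i B nB).
Qed.

Section Multilinear.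
Variables (F : numFieldType) (n : nat) (X : 'I_n -> normedModType F).
Variables (Y : normedModType F) (T : (forall i, X i) -> Y).
Hypothesis mT : multilinear T.

Lemma dfwith_id (z : forall i, X i) i : dfwith z i (z i) = z.
Proof. by apply: functional_extensionality_dep => j; case: dfwithP. Qed.

Lemma multilinear_dfwith0 (z : forall i, X i) i : T (dfwith z i 0) = 0.
Proof.
have := @mT z i 1 0 0; rewrite !scale1r addr0 /= => h.
by apply: (addrI (T (dfwith z i 0))); rewrite addr0 -h.
Qed.

Lemma multilinear_dfwithZ (z : forall i, X i) i c u :
  T (dfwith z i (c *: u)) = c *: T (dfwith z i u).
Proof.
by have := @mT z i c u 0; rewrite addr0 multilinear_dfwith0 addr0.
Qed.

Lemma multilinear_eq0 (z : forall i, X i) i : z i = 0 -> T z = 0.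
Proof. by move=> z0; rewrite -(dfwith_id z i) z0 multilinear_dfwith0. Qed.

Lemma multilinearZ (c : 'I_n -> F) (z : forall i, X i) :
  T (fun i => c i *: z i) = (\prod_i c i) *: T z.
Proof.
pose zk k : forall i, X i := fun i => if (i < k)%N then c i *: z i else z i.
have H k : (k <= n)%N ->
    T (zk k) = (\prod_(i < n | (i < k)%N) c i) *: T z.
  elim: k => [|k IH] kn.
    by rewrite big_pred0 // scale1r.
  pose i0 := Ordinal kn.
  have -> : zk k.+1 = dfwith (zk k) i0 (c i0 *: zk k i0).
    apply: functional_extensionality_dep => j; case: dfwithP => [|j' ij].
      by rewrite /zk /= ltnn leqnn.
    have jk : (j' != k :> nat) by rewrite eq_sym; exact: ij.
    by rewrite /zk ltnS leq_eqVlt (negbTE jk).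
  rewrite multilinear_dfwithZ dfwith_id IH ?(ltnW kn) // scalerA; congr (_ *: _).
  rewrite [RHS](bigD1 i0) //=; congr (_ * _); apply: eq_bigl => j.
  by rewrite -val_eqE /= ltnS ltn_neqAle andbC.
have -> : (fun i => c i *: z i) = zk n.
  by apply: functional_extensionality_dep => i; rewrite /zk ltn_ord.
by rewrite H //; congr (_ *: _); apply: eq_bigl => i; rewrite ltn_ord.
Qed.

End Multilinear.

Section Bounded.
Variables (R : realType) (K : scalar_kind) (n : nat).
Variables (X : 'I_n -> normedModType (scalar R K)) (Y : normedModType (scalar R K)).
Variable T : (forall i, X i) -> Y.

Lemma cvg0_rnorm (Z : normedModType (scalar R K)) (y : nat -> Z) :
  (forall N, rnorm (y N) <= N.+1%:R^-1) -> y N @[N --> \oo] --> (0 : Z).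
Proof.
move=> h; apply/cvgr0Pnorm_lt => e e0.
have eE : e = emb K (real_part e) by rewrite emb_real_part ?ltW.
have e'0 : 0 < real_part e by rewrite -(ltr_emb K) -eE emb0.
have [n0 _ hn0] := near_infty_natSinv_lt (PosNum e'0).
exists n0 => // N /= nN; rewrite norm_rnorm eE ltr_emb.
exact: le_lt_trans (h N) (hn0 N nN).
Qed.

Lemma emb_prod (I : Type) (r : seq I) (f : I -> R) :
  emb K (\prod_(i <- r) f i) = \prod_(i <- r) emb K (f i).
Proof. by elim/big_ind2: _ => [|u1 v1 u2 v2 <- <-|]; rewrite ?emb1 ?embM. Qed.

Lemma multilinear_embZ (mT : multilinear T) (c : 'I_n -> R) (z : forall i, X i) :
  T (fun i => emb K (c i) *: z i) = emb K (\prod_i c i) *: T z.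
Proof. by rewrite multilinearZ // emb_prod. Qed.

(** If T z_N exceeds (N+1)^n on the product of unit balls, then z_N / (N+1) tends to 0
while T stays above 1 there. *)
Lemma cont_multilinear_unit_ball : (0 < n)%N -> cont_multilinear T ->
  exists M, forall z, (forall i, rnorm (z i) <= 1) -> rnorm (T z) <= M.
Proof.
move=> n0 [mT cT]; apply: contrapT => noM.
have /choice[z hz] : forall N : nat, exists z : forall i, X i,
    (forall i, rnorm (z i) <= 1) /\ (N.+1%:R ^+ n < rnorm (T z)).
  move=> N; apply: contrapT => noz; apply: noM; exists (N.+1%:R ^+ n) => z hz.
  by rewrite leNgt; apply/negP => lt; apply: noz; exists z.
pose y N : prod_topology X := fun i => emb K N.+1%:R^-1 *: z N i.
have cy : y @ \oo --> ((fun i => 0) : prod_topology X).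
  apply: cvg_prod_topology => i; apply: cvg0_rnorm => N.
  rewrite rnorm_emb ger0_norm // ler_piMr //.
  by case: (hz N).
have T0 : T (fun i => 0) = 0 by exact: (multilinear_eq0 mT (i := Ordinal n0)).
have h0 : T (y N) @[N --> \oo] --> (0 : Y).
  by rewrite -T0; exact: continuous_cvg (cT _) cy.
have [N _ /(_ N (leqnn N))] := @cvgr0_norm_lt _ Y nat \oo _ (fun N => T (y N)) h0 1 ltr01.
rewrite /=.
rewrite norm_rnorm -(emb1 R K) ltr_emb /y multilinear_embZ // rnorm_emb.
rewrite prodr_const card_ord ger0_norm ?exprn_ge0 // exprVn mulrC ltr_pdivrMr ?exprn_gt0 //.
by rewrite mul1r ltNge; case: (hz N) => _ /ltW ->.
Qed.

Lemma cont_multilinear_bounded : (0 < n)%N -> cont_multilinear T ->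
  exists2 M, 0 <= M & forall z, rnorm (T z) <= M * \prod_i rnorm (z i).
Proof.
move=> n0 cT; have [M hM] := cont_multilinear_unit_ball n0 cT; have [mT _] := cT.
have M0 : 0 <= M.
  apply: le_trans (hM (fun=> 0) _); first exact: rnorm_ge0.
  by move=> i; rewrite rnorm0.
exists M => // z.
have [[i zi]|zN0] := pselect (exists i, z i = 0).
  rewrite (multilinear_eq0 mT zi) rnorm0 mulr_ge0 // prodr_ge0 // => j _.
  exact: rnorm_ge0.
have zp i : 0 < rnorm (z i).
  rewrite lt0r rnorm_ge0 andbT; apply/eqP => /rnorm0_eq0 zi; apply: zN0.
  by exists i.
have -> : T z = T (fun i => emb K (rnorm (z i)) *: (emb K (rnorm (z i))^-1 *: z i)).
  congr (T _); apply: functional_extensionality_dep => i.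
  by rewrite scalerA -embM divff ?gt_eqF // emb1 scale1r.
have P0 : 0 <= \prod_i rnorm (z i) by rewrite prodr_ge0 // => i _; exact: rnorm_ge0.
rewrite multilinear_embZ // rnorm_emb ger0_norm // mulrC ler_wpM2r //.
apply: hM => i; rewrite rnorm_emb ger0_norm ?invr_ge0 ?(ltW (zp i)) //.
by rewrite mulVf // gt_eqF.
Qed.

End Bounded.

(** * Exponents and coordinates *)

Section Exponents.
Variable R : realType.

Lemma inve_ge1 (q : \bar R) : (1 <= q)%E ->
  exists2 t : R, 0 <= t & (q^-1 = t%:E)%E.
Proof.
case: q => [q| |] // q1; last by exists 0 => //; rewrite invey.
have q0 : 0 < q by move: q1; rewrite lee_fin; apply: lt_le_trans.
by exists q^-1; rewrite ?invr_ge0 ?ltW // inver gt_eqF.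
Qed.

Lemma sum_inv_exponents (n k : nat) (hkn : (k <= n)%N) (a : 'I_k -> R) (q : \bar R)
    (t : R) : (forall j, a j != 0) -> (q^-1 = t%:E)%E ->
  (\sum_(i < n) (exponents a q i)^-1 = (\sum_(j < k) (a j)^-1 + (n - k)%:R * t)%:E)%E.
Proof.
move=> a0 qt.
pose g i : \bar R := (if insub i is Some j then (a j)%:E else q).
have -> : (\sum_(i < n) (exponents a q i)^-1 = \sum_(0 <= i < n) (g i)^-1)%E.
  by rewrite big_mkord.
rewrite (big_cat_nat (leq0n k) hkn) /= EFinD; congr (_ + _)%E.
  rewrite big_mkord -sumEFin; apply: eq_bigr => j _.
  by rewrite /g valK inver (negbTE (a0 j)).
rewrite (eq_big_nat _ _ (F2 := fun=> t%:E)) => [|i /andP[ki _]]; last first.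
  by rewrite /g insubN ?qt // -leqNgt.
by rewrite sumEFin big_const_nat iter_addr_0 mulr_natl.
Qed.

Lemma powR_prod (I : Type) (r : seq I) (P : pred I) (f : I -> R) (b : R) :
  (forall i, P i -> 0 <= f i) ->
  (\prod_(i <- r | P i) f i) `^ b = \prod_(i <- r | P i) f i `^ b.
Proof.
move=> f0; elim: r => [|i r IH]; first by rewrite !big_nil powR1.
rewrite !big_cons; case: ifP => // Pi.
by rewrite powRM ?IH ?f0 // prodr_ge0.
Qed.

(** With e the sum over j of v_j^(s_j) and W = s sum_j 1/s_j, each product satisfies
(prod_j v_j)^s <= e^W.  As W >= 1 and e is bounded, e^W is at most a multiple of e,
which is summable. *)
Lemma sum_prod_le (k : nat) (s : R) (sj : 'I_k -> R) (v : 'I_k -> nat -> R) (C : 'I_k -> R) :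
  0 < s -> (forall j, 0 < sj j) -> s^-1 <= \sum_(j < k) (sj j)^-1 ->
  (forall j m, 0 <= v j m) ->
  (forall j N, \sum_(m < N) v j m `^ sj j <= C j) ->
  exists A, forall N, \sum_(m < N) (\prod_(j < k) v j m) `^ s <= A.
Proof.
move=> s0 sj0 hs v0 hC.
pose e m := \sum_(j < k) v j m `^ sj j.
pose E := \sum_(j < k) C j.
pose W := \sum_(j < k) s / sj j.
have e0 m : 0 <= e m by apply: sumr_ge0 => j _; exact: powR_ge0.
have W1 : 0 <= W - 1.
  rewrite subr_ge0 /W -mulr_sumr -(mulfV (lt0r_neq0 s0)) ler_wpM2l ?(ltW s0) //.
have sumE N : \sum_(m < N) e m <= E.
  by rewrite exchange_big; apply: ler_sum => j _; exact: hC.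
have E0 : 0 <= E by have := sumE 0%N; rewrite big_ord0.
have eE m : e m <= E.
  by apply: le_trans (sumE m.+1); rewrite big_ord_recr /= lerDr sumr_ge0.
exists (E * E `^ (W - 1)) => N.
apply: (@le_trans _ _ (\sum_(m < N) e m * E `^ (W - 1))); last first.
  by rewrite -mulr_suml ler_wpM2r ?powR_ge0.
apply: ler_sum => m _.
apply: (@le_trans _ _ (e m `^ W)); last first.
  have W0 : 0 < W by lra.
  by rewrite -(mulr_powRB1 (e0 m) W0) ler_wpM2l // ge0_ler_powR ?nnegrE.
have powR_sum (x : R) (h : 0 <= x) : x `^ W = \prod_(j < k) x `^ (s / sj j).
  rewrite /W; have [x0|xN0] := eqVneq x 0; last first.
    elim/big_ind2: _ => [|u1 v1 u2 v2 h1 h2|//]; first by rewrite powRr0.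
    by rewrite powRD ?h1 ?h2 // xN0 implybT.
  have W0 : 0 < W by lra.
  rewrite x0 powR0 ?gt_eqF //; have kp : (0 < k)%N.
    rewrite lt0n; apply/negP => /eqP k0; move: W0; rewrite /W big1 ?ltxx // => j.
    by move: (nat_of_ord j) (ltn_ord j) => i; rewrite k0.
  rewrite (bigD1 (Ordinal kp)) //= powR0 ?mul0r //.
  by rewrite mulf_neq0 ?invr_neq0 ?gt_eqF.
rewrite powR_sum // powR_prod //; apply: ler_prod => j _.
rewrite powR_ge0 /=.
have -> : v j m `^ s = (v j m `^ sj j) `^ (s / sj j).
  by rewrite -powRrM mulrCA divff ?mulr1 ?gt_eqF.
rewrite ge0_ler_powR ?nnegrE ?powR_ge0 ?divr_ge0 ?(ltW s0) ?(ltW (sj0 j)) //.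
by rewrite /e (bigD1 j) //= lerDl sumr_ge0 // => i _; exact: powR_ge0.
Qed.

(** Both a^s and b^p are at most their sum S, and t^r is a product of powers of a^s and
b^p whose exponents add up to 1; so t^r <= S. *)
Lemma powR_interpolate_le (a b t s p r theta : R) : 0 <= a -> 0 <= b ->
  0 < s -> 0 < p -> 0 < r -> 0 < theta < 1 ->
  r^-1 = (1 - theta) / s + theta / p ->
  t = a `^ (1 - theta) * b `^ theta -> t `^ r <= a `^ s + b `^ p.
Proof.
move=> a0 b0 s0 p0 r0 /andP[th0 th1] rE ->.
set S := a `^ s + b `^ p.
have S0 : 0 <= S by rewrite addr_ge0 ?powR_ge0.
have e1 : (1 - theta) * r / s + theta * r / p = 1.
  by transitivity (r * r^-1); [rewrite rE; ring | rewrite mulfV ?gt_eqF].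
have c1 : 0 <= (1 - theta) * r / s by rewrite !mulr_ge0 ?invr_ge0 ?ltW ?subr_gt0.
have c2 : 0 <= theta * r / p by rewrite !mulr_ge0 ?invr_ge0 ?ltW.
rewrite powRM ?powR_ge0 // -!powRrM.
have -> : a `^ ((1 - theta) * r) = (a `^ s) `^ ((1 - theta) * r / s).
  by rewrite -powRrM [s * _]mulrC divfK ?gt_eqF.
have -> : b `^ (theta * r) = (b `^ p) `^ (theta * r / p).
  by rewrite -powRrM [p * _]mulrC divfK ?gt_eqF.
have -> : S = S `^ ((1 - theta) * r / s) * S `^ (theta * r / p).
  by rewrite -powRD ?e1 ?powRr1 // oner_eq0.
apply: ler_pM; rewrite ?powR_ge0 //.
  by rewrite ge0_ler_powR ?nnegrE ?powR_ge0 // lerDl powR_ge0.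
by rewrite ge0_ler_powR ?nnegrE ?powR_ge0 // lerDr powR_ge0.
Qed.

End Exponents.

Section Coordinates.
Variables (R : realType) (K : scalar_kind) (X : normedModType (scalar R K)).
Implicit Types (x : nat -> X).

Lemma ell_bounded s x : 1 <= s -> ell s x -> exists B, forall m, rnorm (x m) <= B.
Proof.
move=> s1 /ellP[C hC]; exists (1 + `|C|) => m.
have [v1|v1] := leP (rnorm (x m)) 1; first by rewrite (le_trans v1) // lerDl.
apply: (le_trans (le1r_powR (ltW v1) s1)).
apply: (@le_trans _ _ C); last by rewrite (le_trans (ler_norm _)) // lerDr.
apply: le_trans (hC m.+1); rewrite big_ord_recr /= lerDr sumr_ge0 // => i _.
exact: powR_ge0.
Qed.

Lemma weak_ell_bounded q x : (1 <= q)%E -> weak_ell q x ->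
  exists B, forall m, rnorm (x m) <= B.
Proof.
case: q => [q| |] // q1 /weak_ellP[C hC]; exists (1 + `|C|) => m.
have [phi Bphi <-] := norming_functional (x m).
apply: (le_trans (ler_norm _)); apply: (le_trans (real_part_le_rnorm _)).
set v := rnorm _.
have [v1|v1] := leP v 1; first by rewrite (le_trans v1) // lerDl.
apply: (le_trans (le1r_powR (ltW v1) q1)).
apply: (@le_trans _ _ C); last by rewrite (le_trans (ler_norm _)) // lerDr.
apply: le_trans (hC _ Bphi m.+1); rewrite big_ord_recr /= lerDr sumr_ge0 // => i _.
exact: powR_ge0.
Qed.

Lemma weights_interpolation x s p r theta : has_cotype s X -> 2 <= s ->
  0 < theta < 1 -> 1 <= p ->
  (p - 1) * (s - 1) <= 1 -> (2 < s -> (p - 1) * (s - 1) < 1) ->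
  r^-1 = (1 - theta) / 1 + theta / p -> weak_ell r%:E x ->
  exists w0 w1 : nat -> R,
    [/\ forall j, 0 < w0 j, forall j, 0 < w1 j,
      forall j, w0 j `^ (1 - theta) * w1 j `^ theta = 1,
      ell s (fun j => emb K (w0 j) *: x j) &
      weak_ell p%:E (fun j => emb K (w1 j) *: x j)].
Proof.
move=> cot s2 th; rewrite le_eqVlt => /predU1P[<- _ _|p1]; last first.
  exact: weights_interpolation_gt1.
rewrite !divr1 subrK => /(congr1 GRing.inv); rewrite invrK invr1 => -> wx.
have E : (fun j => emb K 1 *: x j) = x.
  by apply/funext => j; rewrite emb1 scale1r.
exists (fun=> 1), (fun=> 1); split; rewrite ?E //.
- by move=> j; rewrite !powR1 mulr1.
by apply: ell_of_weak_ell1 => //; lra.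
Qed.

End Coordinates.

(** * The inclusion *)

Lemma hoelder_conjugate_lt (R : realType) (s p : R) : 1 < s ->
  (p%:E < hoelder_conjugate s%:E)%E -> (p - 1) * (s - 1) < 1.
Proof.
move=> s1; have s10 : 0 < s - 1 by rewrite subr_gt0.
rewrite /hoelder_conjugate /= eqe gt_eqF ?(lt_trans ltr01) // -EFinD inver.
rewrite gt_eqF // -EFinM lte_fin ltr_pdivlMr //; lra.
Qed.

Lemma exponents_widen (R : realType) (n k : nat) (hkn : (k <= n)%N) (a : 'I_k -> R)
  (q : \bar R) (j : 'I_k) : exponents a q (widen_ord hkn j) = (a j)%:E.
Proof. by rewrite /exponents /= valK. Qed.

Lemma exponents_ge (R : realType) (n k : nat) (a : 'I_k -> R)
  (q : \bar R) (i : 'I_n) : (k <= i)%N -> exponents a q i = q.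
Proof. by move=> ki; rewrite /exponents insubN // -leqNgt. Qed.

Section Main.
Variables (R : realType) (K : scalar_kind).

(** Boundedness of T leaves the product of the first k norms times a constant that
bounds the other coordinates. *)
Lemma ell_cont_multilinear (n k : nat) (hkn : (k <= n)%N)
  (X : 'I_n -> normedModType (scalar R K)) (Y : normedModType (scalar R K))
  (T : (forall i, X i) -> Y) (s : R) (sj : 'I_k -> R)
  (x : forall i, nat -> X i) :
  (0 < n)%N -> cont_multilinear T -> 0 < s -> (forall j, 0 < sj j) ->
  s^-1 <= \sum_(j < k) (sj j)^-1 ->
  (forall j, ell (sj j) (x (widen_ord hkn j))) ->
  (forall i, exists B, forall m, rnorm (x i m) <= B) ->
  ell s (fun m => T (fun i => x i m)).
Proof.
move=> n0 cT s0 sj0 hs hx hB.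
have [M M0 hM] := cont_multilinear_bounded n0 cT.
have /choice[B {}hB] := hB.
have /choice[C hC] := fun j => (ellP (sj j) (x (widen_ord hkn j))).1 (hx j).
have [A hA] := sum_prod_le s0 sj0 hs (fun j m => rnorm_ge0 (x (widen_ord hkn j) m)) hC.
pose D := M * \prod_(i < n | ~~ (i < k)%N) B i.
have B0 i : 0 <= B i by exact: le_trans (rnorm_ge0 _) (hB i 0%N).
have D0 : 0 <= D by rewrite mulr_ge0 // prodr_ge0.
apply/ellP; exists (D `^ s * A) => N.
apply: (@le_trans _ _ (D `^ s * \sum_(m < N)
    (\prod_(j < k) rnorm (x (widen_ord hkn j) m)) `^ s)); last first.
  by rewrite ler_wpM2l ?powR_ge0.
rewrite mulr_sumr; apply: ler_sum => m _.
have P0 : 0 <= \prod_(j < k) rnorm (x (widen_ord hkn j) m).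
  by rewrite prodr_ge0 // => j _; exact: rnorm_ge0.
rewrite -powRM // ge0_ler_powR ?nnegrE ?rnorm_ge0 ?(mulr_ge0 D0 P0) ?(ltW s0) //.
apply: (le_trans (hM _)); rewrite /D -mulrA ler_wpM2l //.
rewrite (bigID (fun i : 'I_n => (i < k)%N)) /= mulrC.
rewrite (big_ord_narrow hkn) ler_wpM2r //.
by apply: ler_prod => i _; rewrite rnorm_ge0 hB.
Qed.

End Main.

Theorem theorem2p3 (R : realType) (K : scalar_kind) (s : R) (hs : 1 <= s)
  (n k : nat) (hk : (0 < k)%N) (hkn : (k <= n)%N)
  (X : 'I_n -> completeNormedModType (scalar R K))
  (Y : completeNormedModType (scalar R K))
  (sj : 'I_k -> R)
  (hsj : forall j, 2 <= sj j)
  (hcotype : forall j, has_cotype (sj j) (X (widen_ord hkn j)))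
  (hs_sj : s^-1 <= \sum_(j < k) (sj j)^-1)
  (q : \bar R) (hq : (1 <= q)%E)
  (theta : R) (htheta : 0 < theta < 1)
  (pj : 'I_k -> R)
  (hpj2 : forall j, sj j = 2 -> 1 <= pj j <= 2)
  (hpj : forall j, 2 < sj j ->
     1 <= pj j /\ ((pj j)%:E < hoelder_conjugate (sj j)%:E)%E)
  (p : R) (hp : 0 < p)
  (hp_le : ((p^-1)%:E
     <= (\sum_(j < k) (pj j)^-1)%:E + (n - k)%:R%:E * q^-1)%E)
  (r : R) (hr : r^-1 = (1 - theta) / s + theta / p)
  (rj : 'I_k -> R)
  (hrj : forall j, (rj j)^-1 = (1 - theta) / 1 + theta / pj j) :
  summing p (exponents pj q) X Y `<=` summing r (exponents rj q) X Y.
Proof.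
move=> T [_ cT sT].
have [th0 th1] := andP htheta; have th1' : 0 < 1 - theta by rewrite subr_gt0.
have n0 : (0 < n)%N := leq_trans hk hkn.
have s0 : 0 < s := lt_le_trans ltr01 hs.
have sj0 j : 0 < sj j by apply: lt_le_trans (hsj j).
have hpj1 j : 1 <= pj j.
  have := hsj j; rewrite le_eqVlt => /predU1P[/esym/hpj2/andP[]//|/hpj[]//].
have hps j : (pj j - 1) * (sj j - 1) <= 1 /\
    (2 < sj j -> (pj j - 1) * (sj j - 1) < 1).
  have lt2 : 2 < sj j -> (pj j - 1) * (sj j - 1) < 1.
    move=> h; have [_] := hpj j h; apply: hoelder_conjugate_lt.
    by apply: lt_trans h; rewrite ltr1n.
  split=> //; have := hsj j; rewrite le_eqVlt => /predU1P[E|/lt2/ltW//].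
  by have /andP[_] := hpj2 j (esym E); rewrite -E; lra.
have pj0 j : 0 < pj j := lt_le_trans ltr01 (hpj1 j).
have ri0 : 0 < r^-1 by rewrite hr addr_gt0 // divr_gt0.
have r0 : 0 < r by rewrite -invr_gt0.
split=> //.
- have [t t0 qt] := inve_ge1 hq.
  have rjN0 j : rj j != 0.
    by rewrite -invr_eq0 hrj divr1 gt_eqF // addr_gt0 // divr_gt0.
  rewrite (sum_inv_exponents hkn rjN0 qt) lee_fin.
  move: hp_le; rewrite qt -EFinM -EFinD lee_fin => hp_le'.
  have E : \sum_(j < k) (rj j)^-1 =
      (1 - theta) * k%:R + theta * \sum_(j < k) (pj j)^-1.
    under eq_bigr do rewrite hrj divr1.
    by rewrite big_split /= sumr_const card_ord mulr_sumr mulr_natr.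
  have sk : s^-1 <= k%:R.
    apply: (le_trans hs_sj); apply: (@le_trans _ _ (\sum_(j < k) 1)).
      by apply: ler_sum => j _; rewrite invf_le1 // (le_trans _ (hsj j)) // ler1n.
    by rewrite sumr_const card_ord.
  have nt0 : 0 <= (n - k)%:R * t by rewrite mulr_ge0.
  rewrite hr E.
  have h1 : (1 - theta) / s <= (1 - theta) * k%:R by rewrite ler_wpM2l // ltW.
  have h2 : theta / p <= theta * (\sum_(j < k) (pj j)^-1 + (n - k)%:R * t).
    by rewrite ler_wpM2l // ltW.
  have h3 : 0 <= (1 - theta) * ((n - k)%:R * t) by rewrite mulr_ge0 // ltW.
  move: h1 h2 h3; set u := (n - k)%:R * t; set v := \sum_(j < k) _.
  set k' := k%:R; lra.
move=> x wx.
have coord i : exists w : (nat -> R) * (nat -> R),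
    [/\ (forall m, 0 < w.1 m) /\ (forall m, 0 < w.2 m),
       forall m, w.1 m `^ (1 - theta) * w.2 m `^ theta = 1,
       forall j, widen_ord hkn j = i -> ell (sj j) (fun m => emb K (w.1 m) *: x i m),
       exists B, forall m, rnorm (emb K (w.1 m) *: x i m) <= B &
       weak_ell (exponents pj q i) (fun m => emb K (w.2 m) *: x i m)].
  have := wx i; have [ik|ki] := ltnP i k; last first.
    rewrite !exponents_ge // => wxi; exists (fun=> 1, fun=> 1) => /=.
    have E : (fun m => emb K 1 *: x i m) = x i.
      by apply/funext => j; rewrite emb1 scale1r.
    split; rewrite ?E //.
    - by move=> m; rewrite !powR1 mulr1.
    - by move=> j ji; move: ki; rewrite -ji /= leqNgt ltn_ord.
    - have [B hB] := weak_ell_bounded hq wxi; exists B => m.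
      by rewrite emb1 scale1r.
  pose j := Ordinal ik; have ji : i = widen_ord hkn j by apply: val_inj.
  rewrite ji !exponents_widen => wxi.
  have [h1 h2] := hps j.
  have [w0 [w1 [w00 w10 w01 ell0 weak1]]] :=
    weights_interpolation (hcotype j) (hsj j) htheta (hpj1 j) h1 h2 (hrj j) wxi.
  exists (w0, w1); split=> //=.
  - by move=> j' /(congr1 val) /= jE; have -> : j' = j by apply: val_inj.
  - by apply: ell_bounded ell0; rewrite (le_trans _ (hsj j)) // ler1n.
have /choice[w hw] := coord.
pose y0 i m := emb K ((w i).1 m) *: x i m.
pose y1 i m := emb K ((w i).2 m) *: x i m.
have mT : multilinear T by case: cT.
have /ellP[A hA] : ell s (fun m => T (fun i => y0 i m)).
  apply: (@ell_cont_multilinear R K n k hkn X Y T s sj y0) => //.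
  - by move=> j; case: (hw (widen_ord hkn j)) => _ _ + _ _; exact.
  - by move=> i; case: (hw i).
have /ellP[B hB] : ell p (fun m => T (fun i => y1 i m)).
  by apply: sT => i; case: (hw i).
apply/ellP; exists (A + B) => N.
apply: (@le_trans _ _ (\sum_(m < N) (rnorm (T (fun i => y0 i m)) `^ s +
    rnorm (T (fun i => y1 i m)) `^ p))); last by rewrite big_split lerD.
apply: ler_sum => m _.
apply: (@powR_interpolate_le R _ _ _ s p r theta) => //; try exact: rnorm_ge0.
have W0 i : 0 < (w i).1 m by case: (hw i) => -[].
have W1 i : 0 < (w i).2 m by case: (hw i) => -[].
rewrite /y0 /y1 !multilinear_embZ // !rnorm_emb.
have P0 : 0 <= \prod_i (w i).1 m by rewrite prodr_ge0 // => i _; exact: ltW.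
have P1 : 0 <= \prod_i (w i).2 m by rewrite prodr_ge0 // => i _; exact: ltW.
rewrite !ger0_norm // !powRM ?rnorm_ge0 // !powR_prod => [|i _|i _]; try exact: ltW.
rewrite mulrACA -big_split /= big1 ?mul1r => [|i _]; last by case: (hw i).
rewrite -powRD ?subrK ?powRr1 ?rnorm_ge0 // oner_eq0 //.
Qed.
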